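(* Let $({}_{f_2}M_1\times{}_{f_1}M_2,F)$ be a doubly warped product Finsler manifold. Then the Vaisman connection $\nabla^v$ on $(TM^\circ,\mathcal{F}_V,\mathbf{G})$ is locally expressed with respect to the adapted local basis $\{\frac{\delta^d}{\delta^dx^i},\frac{\delta^d}{\delta^du^\alpha},\frac{\partial}{\partial y^i},\frac{\partial}{\partial v^\alpha}\}$ as follows: $$\nabla^v_{\frac{\delta^d}{\delta^dx^i}}\frac{\partial}{\partial y^j}=\mathbf{G}^k_{ij}\frac{\partial}{\partial y^k}+\mathbf{G}^\gamma_{ij}\frac{\partial}{\partial v^\gamma},\qquad \nabla^v_{\frac{\delta^d}{\delta^du^\alpha}}\frac{\partial}{\partial v^\beta}=\mathbf{G}^k_{\alpha\beta}\frac{\partial}{\partial y^k}+\mathbf{G}^\gamma_{\alpha\beta}\frac{\partial}{\partial v^\gamma},$$ $$\nabla^v_{\frac{\delta^d}{\delta^du^\alpha}}\frac{\partial}{\partial y^j}=\mathbf{G}^k_{\alpha j}\frac{\partial}{\partial y^k}+\mathbf{G}^\gamma_{\alpha j}\frac{\partial}{\partial v^\gamma},\qquad \nabla^v_{\frac{\delta^d}{\delta^dx^i}}\frac{\partial}{\partial v^\beta}=\mathbf{G}^k_{i\beta}\frac{\partial}{\partial y^k}+\mathbf{G}^\gamma_{i\beta}\frac{\partial}{\partial v^\gamma},$$ $$\nabla^v_{\frac{\delta^d}{\delta^dx^i}}\frac{\delta^d}{\delta^dx^j}=\mathbf{F}^k_{ij}\frac{\delta^d}{\delta^dx^k}+\mathbf{F}^\gamma_{ij}\frac{\delta^d}{\delta^du^\gamma},\qquad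 \nabla^v_{\frac{\delta^d}{\delta^du^\alpha}}\frac{\delta^d}{\delta^du^\beta}=\mathbf{F}^k_{\alpha\beta}\frac{\delta^d}{\delta^dx^k}+\mathbf{F}^\gamma_{\alpha\beta}\frac{\delta^d}{\delta^du^\gamma},$$ $$\nabla^v_{\frac{\delta^d}{\delta^dx^i}}\frac{\delta^d}{\delta^du^\beta}=\mathbf{F}^k_{i\beta}\frac{\delta^d}{\delta^dx^k}+\mathbf{F}^\gamma_{i\beta}\frac{\delta^d}{\delta^du^\gamma},\qquad \nabla^v_{\frac{\delta^d}{\delta^du^\alpha}}\frac{\delta^d}{\delta^dx^j}=\mathbf{F}^k_{\alpha j}\frac{\delta^d}{\delta^dx^k}+\mathbf{F}^\gamma_{\alpha j}\frac{\delta^d}{\delta^du^\gamma},$$ $$\nabla^v_{\frac{\partial}{\partial y^i}}\frac{\partial}{\partial y^j}=C^k_{ij}\frac{\partial}{\partial y^k},\qquad \nabla^v_{\frac{\partial}{\partial v^\alpha}}\frac{\partial}{\partial v^\beta}=C^\gamma_{\alpha\beta}\frac{\partial}{\partial v^\gamma},\qquad \nabla^v_{\frac{\partial}{\partial y^i}}\frac{\partial}{\partial v^\beta}=\nabla^v_{\frac{\partial}{\partial v^\alpha}}\frac{\partial}{\partial y^j}=0,$$ $$\nabla^v_{\frac{\partial}{\partial y^i}}\frac{\delta^d}{\delta^dx^j}=\nabla^v_{\frac{\partial}{\partial v^\alpha}}\frac{\delta^d}{\delta^dx^j}=\nabla^v_{\frac{\partial}{\partial v^\alpha}}\frac{\delta^d}{\delta^du^\beta}=\nabla^v_{\frac{\partial}{\partial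 y^i}}\frac{\delta^d}{\delta^du^\beta}=0.$$
   Context: A Finsler metric on a manifold $M$ is a function $F:TM\to[0,\infty)$ that is $C^\infty$ on the slit tangent bundle $TM^\circ$, positively $1$-homogeneous on fibres, and whose fibre Hessian of $\frac12F^2$ is positive definite. Let $(M_1,F_1)$, $(M_2,F_2)$ be Finsler manifolds and let $f_1:M_1\to\mathbb{R}^+$, $f_2:M_2\to\mathbb{R}^+$ be smooth. The doubly warped product Finsler manifold $({}_{f_2}M_1\times{}_{f_1}M_2,F)$ is $M=M_1\times M_2$ with $$F(v_1,v_2)=\sqrt{f_2^2(\pi_2(v_2))F_1^2(v_1)+f_1^2(\pi_1(v_1))F_2^2(v_2)},\qquad (v_1,v_2)\in TM^\circ:=TM_1^\circ\times TM_2^\circ,$$ where $\pi_1,\pi_2$ are the base-point projections. Local induced coordinates are $(x^i,y^i)$ on $TM_1$, $(u^\alpha,v^\alpha)$ on $TM_2$, and $\mathbf{x}^a=(x^i,u^\alpha)$, $\mathbf{y}^a=(y^i,v^\alpha)$ on $TM$; Latin $i,j,k,h$ and Greek indices denote $M_1$- and $M_2$-components; repeated indices are summed. $g_{ij}=\frac12\frac{\partial^2F_1^2}{\partial y^i\partial y^j}$, $g_{\alpha\beta}=\frac12\frac{\partial^2F_2^2}{\partial v^\alpha\partial v^\beta}$, $\mathbf{g}_{ab}=\frac12\frac{\partial^2F^2}{\partial\mathbf{y}^a\partial\mathbf{y}^b}$, inverses with upper indices; $C^k_{ij}=\frac12g^{kh}\frac{\partial g_{ij}}{\partial y^h}$,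 $C^\gamma_{\alpha\beta}=\frac12g^{\gamma\lambda}\frac{\partial g_{\alpha\beta}}{\partial v^\lambda}$. Put $\mathbf{G}^a=\frac14\mathbf{g}^{ab}\big(\frac{\partial^2F^2}{\partial\mathbf{y}^b\partial\mathbf{x}^c}\mathbf{y}^c-\frac{\partial F^2}{\partial\mathbf{x}^b}\big)$, $\mathbf{G}^a_b=\frac{\partial\mathbf{G}^a}{\partial\mathbf{y}^b}$, $\mathbf{G}^c_{ab}=\frac{\partial\mathbf{G}^c_a}{\partial\mathbf{y}^b}$, $\frac{\delta^d}{\delta^d\mathbf{x}^a}=\frac{\partial}{\partial\mathbf{x}^a}-\mathbf{G}^b_a\frac{\partial}{\partial\mathbf{y}^b}$ (components $\frac{\delta^d}{\delta^dx^i},\frac{\delta^d}{\delta^du^\alpha}$; the superscript $d$ is a label), and $$\mathbf{F}^c_{ab}=\tfrac12\mathbf{g}^{ce}\Big(\frac{\delta^d\mathbf{g}_{ea}}{\delta^d\mathbf{x}^b}+\frac{\delta^d\mathbf{g}_{eb}}{\delta^d\mathbf{x}^a}-\frac{\delta^d\mathbf{g}_{ab}}{\delta^d\mathbf{x}^e}\Big).$$ $VTM^\circ=\mathrm{span}\{\frac{\partial}{\partial\mathbf{y}^a}\}$, $HTM^\circ=\mathrm{span}\{\frac{\delta^d}{\delta^d\mathbf{x}^a}\}$, $TTM^\circ=HTM^\circ\oplus VTM^\circ$, with projections $h^d$ onto $HTM^\circ$ and $v^d$ onto $VTM^\circ$; $\mathcal{F}_V$ is the foliation of $TM^\circ$ tangent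 to $VTM^\circ$. The doubly warped Sasaki–Matsumoto metric is the Riemannian metric $\mathbf{G}=\mathbf{g}_{ab}\,d\mathbf{x}^a\otimes d\mathbf{x}^b+\mathbf{g}_{ab}\,\delta^d\mathbf{y}^a\otimes\delta^d\mathbf{y}^b$ on $TM^\circ$, $\delta^d\mathbf{y}^a=d\mathbf{y}^a+\mathbf{G}^a_b\,d\mathbf{x}^b$. The Vaisman connection $\nabla^v$ on $(TM^\circ,\mathcal{F}_V,\mathbf{G})$ is the linear connection uniquely determined by: (i) if $Y\in\Gamma(VTM^\circ)$ (resp. $\Gamma(HTM^\circ)$) then $\nabla^v_XY\in\Gamma(VTM^\circ)$ (resp. $\Gamma(HTM^\circ)$) for every $X$; (ii) if $X,Y,Z\in\Gamma(VTM^\circ)$, or $X,Y,Z\in\Gamma(HTM^\circ)$, then $(\nabla^v_X\mathbf{G})(Y,Z)=0$; (iii) with $T$ the torsion of $\nabla^v$, $v^d(T(X,Y))=0$ if at least one of $X,Y$ is in $\Gamma(VTM^\circ)$, and $h^d(T(X,Y))=0$ if at least one of $X,Y$ is in $\Gamma(HTM^\circ)$. *)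

(* Defs.v *)
(* MathComp / MathComp-Analysis *)
From HB Require Import structures.
From mathcomp Require Import all_boot all_order all_algebra.
From mathcomp Require Import all_classical all_reals all_analysis.

Set Implicit Arguments.
Unset Strict Implicit.
Unset Printing Implicit Defensive.

Import Order.TTheory GRing.Theory Num.Theory numFieldNormedType.Exports.

Local Open Scope classical_set_scope.
Local Open Scope ring_scope.

(* C^oo on the open set U: every iterated directional derivative is Frechet
   differentiable at every point of U. *)
Definition smooth_on (R : realType) (V W : normedModType R) (U : set V)
    (f : V -> W) : Prop :=
  forall (vs : seq V) (x : V), U x ->
    differentiable (foldr (fun v g => 'D_v g) f vs) x.

(* The topology of M is the one induced by the charts (see [chart_open]);
   [point c] inverts [coord c] and is only meaningful on [chart_image c]. *)
Record atlas (R : realType) (M : Type) (n : nat) := Atlas {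
  chart : Type;
  dom : chart -> set M;
  coord : chart -> M -> 'rV[R]_n;
  point : chart -> 'rV[R]_n -> M }.

Section AtlasNotions.
Context (R : realType) (M : Type) (n : nat) (A : atlas R M n).
Implicit Types c d : chart A.

Definition chart_image c : set 'rV[R]_n := coord c @` dom c.
Definition overlap c d : set 'rV[R]_n := coord c @` (dom c `&` dom d).
Definition transition c d : 'rV[R]_n -> 'rV[R]_n := coord d \o point c.
Definition chart_open (U : set M) : Prop :=
  forall c, open (coord c @` (dom c `&` U)).

Record smooth_atlas : Prop := SmoothAtlas {
  coordK : forall c p, dom c p -> point c (coord c p) = p;
  overlap_open : forall c d, open (overlap c d);
  transition_smooth : forall c d, smooth_on (overlap c d) (transition c d);
  atlas_hausdorff : forall p q, p <> q -> exists U V,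
    [/\ chart_open U, chart_open V, U p, V q & U `&` V = set0];
  (* equivalent to second countability *)
  atlas_countable_cover : exists2 C : set (chart A), countable C &
    forall p, exists2 c, C c & dom c p }.

End AtlasNotions.

Record manifold (R : realType) (n : nat) := Manifold {
  carrier :> Type;
  atlas_of : atlas R carrier n;
  atlas_ofP : smooth_atlas atlas_of }.

Section Tangent.
Context (R : realType) (n : nat) (M : manifold R n).
Implicit Types c d : chart (atlas_of M).

(* A tangent vector is the family of its component vectors in all charts at its
   base point; outside those charts the component is set to 0, so that equality
   of tangent vectors is the intended one. *)
Definition coherent (p : M) (v : chart (atlas_of M) -> 'rV[R]_n) : Prop :=
  (forall c, ~ dom c p -> v c = 0) /\
  (forall c d, dom c p -> dom d p ->
     v d = 'D_(v c) (transition c d) (coord c p)).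

Record tangent := Tangent {
  base : M;
  tcomp : chart (atlas_of M) -> 'rV[R]_n;
  tcomp_coherent : coherent base tcomp }.

Definition tvec_comp c (x y : 'rV[R]_n) d : 'rV[R]_n :=
  if `[< chart_image c x /\ dom d (point c x) >]
  then 'D_y (transition c d) x else 0.

Lemma tvec_coherent c (x y : 'rV[R]_n) :
  coherent (point c x) (tvec_comp c x y).
Proof.
have AP := atlas_ofP M; rewrite /tvec_comp; split=> [d nd|d e dd de].
  by case: asboolP => // -[].
have [xc|nxc] := pselect (chart_image c x); last first.
  rewrite asboolF; last by case.
  rewrite asboolF; last by case.
  by rewrite derive0.
rewrite asboolT// asboolT//.
have [p cp px] := xc.
have pxp : point c x = p by rewrite -px (coordK AP).
have oce : overlap c e x by exists p => //; split=> //; rewrite -pxp.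
have ocd : overlap c d x by exists p => //; split=> //; rewrite -pxp.
have ode : overlap d e (transition c d x).
  by exists (point c x) => //; split.
have dcd : differentiable (transition c d) x :=
  @transition_smooth _ _ _ _ AP _ _ [::] _ ocd.
have dde : differentiable (transition d e) (transition c d x) :=
  @transition_smooth _ _ _ _ AP _ _ [::] _ ode.
have -> : 'D_y (transition c e) x = 'D_y (transition d e \o transition c d) x.
  have [->|y0] := eqVneq y 0; first by rewrite !derive0.
  apply: near_eq_derive => //.
  have := open_nbhs_nbhs (conj (@overlap_open _ _ _ _ AP c d) ocd).
  apply: filterS => z [q [cq dq] <-].
  by rewrite /transition /= (coordK AP cq) (coordK AP dq).
rewrite (deriveE y (differentiable_comp dcd dde)) (diff_comp dcd dde) /=.
by rewrite (deriveE y dcd) (deriveE _ dde).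
Qed.

Definition tvec c (x y : 'rV[R]_n) : tangent := Tangent (tvec_coherent c x y).

(* Local expression of a function on TM in the induced coordinates (x, y). *)
Definition local_expr (F : tangent -> R) c : 'rV[R]_(n + n) -> R :=
  fun w => F (tvec c (lsubmx w) (rsubmx w)).

Definition slit_image c : set 'rV[R]_(n + n) :=
  [set w | chart_image c (lsubmx w) /\ rsubmx w != 0].

Definition smooth_fun (f : M -> R) : Prop :=
  forall c, smooth_on (chart_image c) (f \o point c).

End Tangent.

(* Objects attached to a function E on an open set of the (x, y)-space R^(p+p);
   E is the square of a Finsler metric in induced coordinates. *)
Section Spray.
Context (R : realType) (p : nat).
Local Notation V := 'rV[R]_(p + p).
Implicit Types (E f : V -> R) (w X Y : V) (a b c e : 'I_p).

Definition dx f a : V -> R := 'D_(row_mx (delta_mx 0 a) 0) f.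
Definition dy f a : V -> R := 'D_(row_mx 0 (delta_mx 0 a)) f.

Definition fund_tensor E w : 'M[R]_p :=
  \matrix_(a, b) (2%:R^-1 * dy (dy E b) a w).
Definition fund_inv E w : 'M[R]_p := invmx (fund_tensor E w).

(* C^c_{ab} *)
Definition cartan E c a b w : R :=
  2%:R^-1 * \sum_e fund_inv E w c e * dy (fun w' => fund_tensor E w' a b) e w.

(* G^a, G^a_b, G^c_{ab} *)
Definition spray E a w : R :=
  4%:R^-1 * \sum_b fund_inv E w a b *
    (\sum_c dy (dx E c) b w * rsubmx w 0 c - dx E b w).
Definition nonlin_conn E a b w : R := dy (spray E a) b w.
Definition berwald E c a b w : R := dy (nonlin_conn E c a) b w.

Definition delta_deriv E f a w : R :=
  dx f a w - \sum_b nonlin_conn E b a w * dy f b w.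

(* F^c_{ab} *)
Definition chern E c a b w : R :=
  2%:R^-1 * \sum_e fund_inv E w c e *
    (delta_deriv E (fun w' => fund_tensor E w' e a) b w
     + delta_deriv E (fun w' => fund_tensor E w' e b) a w
     - delta_deriv E (fun w' => fund_tensor E w' a b) e w).

(* The adapted frame delta/delta x^a, d/dy^a, and its dual coframe
   dx^a, delta y^a. *)
Definition hframe E a : V -> V :=
  fun w => row_mx (delta_mx 0 a) (- \row_b nonlin_conn E b a w).
Definition vframe a : V -> V := fun=> row_mx 0 (delta_mx 0 a).
Definition hcoframe a X : R := lsubmx X 0 a.
Definition vcoframe E w a X : R :=
  rsubmx X 0 a + \sum_b nonlin_conn E a b w * lsubmx X 0 b.

Definition hproj E w X : V := \sum_a hcoframe a X *: hframe E a w.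
Definition vproj E w X : V := \sum_a vcoframe E w a X *: vframe a w.

Definition horizontal E (U : set V) (X : V -> V) : Prop :=
  forall w, U w -> exists xi : 'I_p -> R, X w = \sum_a xi a *: hframe E a w.
Definition vertical (U : set V) (X : V -> V) : Prop :=
  forall w, U w -> exists xi : 'I_p -> R, X w = \sum_a xi a *: vframe a w.

Definition sasaki_matsumoto E w X Y : R :=
  \sum_a \sum_b fund_tensor E w a b *
     (hcoframe a X * hcoframe b Y + vcoframe E w a X * vcoframe E w b Y).

End Spray.

Record is_finsler (R : realType) (n : nat) (M : manifold R n)
    (F : tangent M -> R) : Prop := IsFinsler {
  finsler_ge0 : forall v, 0 <= F v;
  finsler_smooth : forall c, smooth_on (@slit_image _ _ M c) (local_expr F c);
  finsler_homogeneous : forall c x y (t : R), chart_image c x -> 0 < t ->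
    F (tvec c x (t *: y)) = t * F (tvec c x y);
  finsler_posdef : forall c w, @slit_image _ _ M c w ->
    forall xi : 'rV[R]_n, xi != 0 ->
    0 < \sum_a \sum_b
      fund_tensor (fun w' => local_expr F c w' ^+ 2) w a b * xi 0 a * xi 0 b }.

(* A linear connection on the manifold N given by A is a family of linear
   connections on the chart domains that agree on overlaps. Vector fields on a
   chart domain are written in coordinates, so that X f = 'D_(X w) f w; their
   values outside [chart_image c] are irrelevant. *)
Section LinearConnection.
Context (R : realType) (N : Type) (d : nat) (A : atlas R N d).
Local Notation V := 'rV[R]_d.

Definition lie_bracket (X Y : V -> V) : V -> V :=
  fun w => 'D_(X w) Y w - 'D_(Y w) X w.

Definition torsion (nabla : (V -> V) -> (V -> V) -> V -> V) (X Y : V -> V) :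
    V -> V :=
  fun w => nabla X Y w - nabla Y X w - lie_bracket X Y w.

Record local_connection (U : set V)
    (nabla : (V -> V) -> (V -> V) -> V -> V) : Prop := LocalConnection {
  nabla_smooth : forall X Y, smooth_on U X -> smooth_on U Y ->
    smooth_on U (nabla X Y);
  nabla_addl : forall X X' Y,
    smooth_on U X -> smooth_on U X' -> smooth_on U Y ->
    forall w, U w ->
    nabla (fun w => X w + X' w) Y w = nabla X Y w + nabla X' Y w;
  nabla_scalel : forall (f : V -> R) X Y,
    smooth_on U f -> smooth_on U X -> smooth_on U Y ->
    forall w, U w -> nabla (fun w => f w *: X w) Y w = f w *: nabla X Y w;
  nabla_addr : forall X Y Y',
    smooth_on U X -> smooth_on U Y -> smooth_on U Y' ->
    forall w, U w ->
    nabla X (fun w => Y w + Y' w) w = nabla X Y w + nabla X Y' w;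
  nabla_leibniz : forall (f : V -> R) X Y,
    smooth_on U f -> smooth_on U X -> smooth_on U Y ->
    forall w, U w ->
    nabla X (fun w => f w *: Y w) w
    = 'D_(X w) f w *: Y w + f w *: nabla X Y w }.

Definition related (c c' : chart A) (X X' : V -> V) : Prop :=
  forall w, overlap c c' w ->
    X' (transition c c' w) = 'D_(X w) (transition c c') w.

Record linear_connection
    (nabla : chart A -> (V -> V) -> (V -> V) -> V -> V) : Prop :=
  LinearConnection {
  nabla_local : forall c, local_connection (chart_image c) (nabla c);
  nabla_related : forall c c' X X' Y Y',
    smooth_on (chart_image c) X -> smooth_on (chart_image c') X' ->
    smooth_on (chart_image c) Y -> smooth_on (chart_image c') Y' ->
    related c c' X X' -> related c c' Y Y' ->
    related c c' (nabla c X Y) (nabla c' X' Y') }.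

End LinearConnection.

Section DoublyWarped.
Context (R : realType) (m n : nat) (M1 : manifold R m) (M2 : manifold R n).

(* The atlas of TM1^o x TM2^o by the induced coordinates ((x, u), (y, v)). *)
Definition slit_atlas :
    atlas R (tangent M1 * tangent M2) ((m + n) + (m + n)) :=
  @Atlas R _ _ (chart (atlas_of M1) * chart (atlas_of M2))
    (fun c z => [/\ dom c.1 (base z.1), dom c.2 (base z.2),
                    tcomp z.1 c.1 != 0 & tcomp z.2 c.2 != 0])
    (fun c z => row_mx (row_mx (coord c.1 (base z.1)) (coord c.2 (base z.2)))
                       (row_mx (tcomp z.1 c.1) (tcomp z.2 c.2)))
    (fun c w => (tvec c.1 (lsubmx (lsubmx w)) (lsubmx (rsubmx w)),
                 tvec c.2 (rsubmx (lsubmx w)) (rsubmx (rsubmx w)))).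

Definition doubly_warped (F1 : tangent M1 -> R) (F2 : tangent M2 -> R)
    (f1 : M1 -> R) (f2 : M2 -> R) : tangent M1 * tangent M2 -> R :=
  fun z => Num.sqrt (f2 (base z.2) ^+ 2 * F1 z.1 ^+ 2
                     + f1 (base z.1) ^+ 2 * F2 z.2 ^+ 2).

(* F^2 in the induced coordinates *)
Definition energy (F : tangent M1 * tangent M2 -> R) (c : chart slit_atlas) :
    'rV[R]_((m + n) + (m + n)) -> R :=
  fun w => F (point c w) ^+ 2.

(* (x, u, y, v) |-> (x, y) and (x, u, y, v) |-> (u, v) *)
Definition part1 (w : 'rV[R]_((m + n) + (m + n))) : 'rV[R]_(m + m) :=
  row_mx (lsubmx (lsubmx w)) (lsubmx (rsubmx w)).
Definition part2 (w : 'rV[R]_((m + n) + (m + n))) : 'rV[R]_(n + n) :=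
  row_mx (rsubmx (lsubmx w)) (rsubmx (rsubmx w)).

(* The distributions VTM^o and HTM^o, the projections and the metric are given by
   their expressions in each induced chart; by locality of connections the
   conditions may be imposed on each chart domain. *)
Record vaisman_connection (F : tangent M1 * tangent M2 -> R)
    (nabla : chart slit_atlas ->
       ('rV[R]_((m + n) + (m + n)) -> 'rV[R]_((m + n) + (m + n))) ->
       ('rV[R]_((m + n) + (m + n)) -> 'rV[R]_((m + n) + (m + n))) ->
       'rV[R]_((m + n) + (m + n)) -> 'rV[R]_((m + n) + (m + n))) : Prop :=
  VaismanConnection {
  vaisman_linear : linear_connection nabla;
  vaisman_vertical : forall c X Y,
    smooth_on (chart_image c) X -> smooth_on (chart_image c) Y ->
    vertical (chart_image c) Y -> vertical (chart_image c) (nabla c X Y);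
  vaisman_horizontal : forall c X Y,
    smooth_on (chart_image c) X -> smooth_on (chart_image c) Y ->
    horizontal (energy F c) (chart_image c) Y ->
    horizontal (energy F c) (chart_image c) (nabla c X Y);
  vaisman_metric : forall c X Y Z,
    smooth_on (chart_image c) X -> smooth_on (chart_image c) Y ->
    smooth_on (chart_image c) Z ->
    [/\ vertical (chart_image c) X, vertical (chart_image c) Y &
        vertical (chart_image c) Z] \/
    [/\ horizontal (energy F c) (chart_image c) X,
        horizontal (energy F c) (chart_image c) Y &
        horizontal (energy F c) (chart_image c) Z] ->
    let G := sasaki_matsumoto (energy F c) in
    forall w, chart_image c w ->
    'D_(X w) (fun w' => G w' (Y w') (Z w')) w
    - G w (nabla c X Y w) (Z w) - G w (Y w) (nabla c X Z w) = 0;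
  vaisman_torsion_v : forall c X Y,
    smooth_on (chart_image c) X -> smooth_on (chart_image c) Y ->
    vertical (chart_image c) X \/ vertical (chart_image c) Y ->
    forall w, chart_image c w ->
    vproj (energy F c) w (torsion (nabla c) X Y w) = 0;
  vaisman_torsion_h : forall c X Y,
    smooth_on (chart_image c) X -> smooth_on (chart_image c) Y ->
    horizontal (energy F c) (chart_image c) X \/
    horizontal (energy F c) (chart_image c) Y ->
    forall w, chart_image c w ->
    hproj (energy F c) w (torsion (nabla c) X Y w) = 0 }.

End DoublyWarped.

(* Main.v *)
(* On each chart the conditions are tested on the adapted frame h_a = delta/delta x^a,
   v_a = d/dy^a. The brackets [h_a, v_b] = G^c_ab v_c and [v_a, v_b] = 0 are vertical and
   [h_a, h_b] has no horizontal part. Torsion-freeness of mixed arguments then gives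
   nabla_{h_a} v_b = [h_a, v_b] and nabla_{v_b} h_a = 0, while on V and on H separately
   Koszul's argument determines the coefficients: F^c_ab on H, and on V the Cartan tensor
   of F^2, since the third y-derivatives of F^2 are symmetric. Finally F^2 is, up to the
   factors f_2^2 and f_1^2, which do not depend on y and v, the sum of F_1^2(x, y) and
   F_2^2(u, v), so its fundamental tensor is block diagonal, and the Cartan tensor splits into
   those of F_1 and F_2. *)
Require Import Defs.
From HB Require Import structures.
From mathcomp Require Import all_boot all_order all_algebra.
From mathcomp Require Import all_classical all_reals all_analysis.
From mathcomp Require Import ring lra.
Import Order.TTheory GRing.Theory Num.Theory numFieldNormedType.Exports.
Local Open Scope classical_set_scope.
Local Open Scope ring_scope.

Set Implicit Arguments.
Unset Strict Implicit.
Unset Printing Implicit Defensive.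

(** The conditions on nabla speak only of smooth fields, so the adapted frame must be shown smooth
    before it can be tested. This requires smoothness of G^a_b, hence of the inverse of g_ab; it is
    the reason for the calculus below, since [smooth_on] is given by iterated directional
    derivatives and closure under products and inverses has to be derived from that. Symmetry of
    mixed derivatives enters twice: for the symmetry of the metric, and for the total symmetry of
    the third y-derivatives of F^2, which reduces the three terms of Koszul's formula on V to one.
    Coefficients with an upper index are never found by inverting g_ab explicitly. Both sides are
    lowered with g_ab and compared, as an invertible matrix determines the solution. In the
    splitting of the Cartan tensor this makes the warp factors cancel: f_2^2 multiplies both g_ij
    and its y-derivatives, so the lowered equations for F are those for F_1 times f_2^2. *)

(** * Calculus of smooth functions on open sets *)

Section Smooth.
Context (R : realType) (V : normedModType R).
Implicit Types (W : normedModType R) (U : set V).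

(** The first-order expansion of [f] at [x] is also one of [g], and [diff_unique] identifies its
    linear part with the differential of [g]. *)
Lemma near_eq_differentiable W (f g : V -> W) x :
  (\near x, f x = g x) -> differentiable f x -> differentiable g x.
Proof.
move=> fg df; have fgx := nbhs_singleton fg.
have E : g \o shift x = cst (g x) + 'd f x +o_ 0 id.
  apply/eqaddoP => _/posnumP[e].
  have /eqaddoP/(_ e%:num) := diff_locally df; move=> /(_ (gt0 e)).
  have fg0 : \forall y \near (0 : V), f (y + x) = g (y + x).
    move: fg; rewrite (near_shift 0 x).
    by apply: filterS => y /=; rewrite subr0.
  by apply: filterS2 fg0 => y fgy; rewrite !fctE /= fgy fgx.
have dfc : continuous ('d f x) by apply: diff_continuous.
by apply/diff_locallyP; rewrite (diff_unique dfc E).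
Qed.

(* [smooth_on] truncated at order [k], so that products and inverses can be
   treated by induction on [k]. *)
Fixpoint Ck_on W k U (f : V -> W) : Prop :=
  (forall x, U x -> differentiable f x) /\
  (if k is k'.+1 then forall v, Ck_on k' U ('D_v f) else True).

Lemma Ck_onS W k U (f : V -> W) :
  Ck_on k.+1 U f <->
  (forall x, U x -> differentiable f x) /\ forall v, Ck_on k U ('D_v f).
Proof. by []. Qed.

Lemma Ck_on_differentiable W k U (f : V -> W) x :
  Ck_on k U f -> U x -> differentiable f x.
Proof. by case: k => [|k] []; auto. Qed.

Lemma Ck_onW W k U (f : V -> W) : Ck_on k.+1 U f -> Ck_on k U f.
Proof.
elim: k f => [|k IH] f; first by case.
by rewrite Ck_onS => -[fd fD]; rewrite Ck_onS; split=> // v; apply: IH.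
Qed.

(** In [smooth_on] the last vector of the list is differentiated first, hence the use of [rcons] and
    of induction from the right. *)
Lemma smooth_onP W U (f : V -> W) : smooth_on U f <-> forall k, Ck_on k U f.
Proof.
split=> [fs k|].
  elim: k f fs => [|k IH] f fs; first by split=> // x Ux; exact: (fs [::]).
  rewrite Ck_onS; split=> [x Ux|v]; first exact: (fs [::]).
  by apply: IH => vs x Ux; have := fs (rcons vs v) x Ux; rewrite foldr_rcons.
move=> + vs; elim/last_ind: vs f => [|vs v IH] f fs.
  by move=> x; exact: (@Ck_on_differentiable _ 0 U).
move=> x; rewrite foldr_rcons; apply: IH => k.
by have [_] := (Ck_onS k U f).1 (fs k.+1).
Qed.

Lemma smooth_on_differentiable W U (f : V -> W) x :
  smooth_on U f -> U x -> differentiable f x.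
Proof. by move=> fs; exact: (fs [::]). Qed.

Lemma smooth_on_derive W U (f : V -> W) v :
  smooth_on U f -> smooth_on U ('D_v f).
Proof. by move=> fs vs x; rewrite -foldr_rcons; exact: fs. Qed.

Lemma open_near_eq W U (f g : V -> W) x :
  open U -> {in U, f =1 g} -> U x -> \near x, f x = g x.
Proof.
move=> oU fg Ux; have := open_nbhs_nbhs (conj oU Ux).
by apply: filterS => y Uy; apply: fg; rewrite inE.
Qed.

Lemma eq_in_derive W U (f g : V -> W) v :
  open U -> {in U, f =1 g} -> {in U, 'D_v f =1 'D_v g}.
Proof.
by move=> oU fg x; rewrite inE => Ux; apply: near_eq_derive; exact: open_near_eq Ux.
Qed.

(** Used to replace a derivative by the formula of a differentiation rule, which is valid on [U]
    only. *)
Lemma eq_in_Ck_on W k U (f g : V -> W) :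
  open U -> {in U, f =1 g} -> Ck_on k U f -> Ck_on k U g.
Proof.
move=> oU; elim: k f g => [|k IH] f g fg.
  by case=> fd _; split=> // x Ux; exact: near_eq_differentiable (open_near_eq oU fg Ux) (fd _ Ux).
rewrite !Ck_onS => -[fd fD]; split=> [x Ux|v].
  exact: near_eq_differentiable (open_near_eq oU fg Ux) (fd _ Ux).
exact: (IH _ _ (eq_in_derive v oU fg)).
Qed.

Lemma eq_in_smooth_on W U (f g : V -> W) :
  open U -> {in U, f =1 g} -> smooth_on U f -> smooth_on U g.
Proof.
by move=> oU fg /smooth_onP fs; apply/smooth_onP => k; exact: eq_in_Ck_on (fs k).
Qed.

Lemma smooth_on_sub W U U' (f : V -> W) :
  U `<=` U' -> smooth_on U' f -> smooth_on U f.
Proof. by move=> UU' fs vs x /UU'; exact: fs. Qed.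

Lemma Ck_on_cst W k U (a : W) : Ck_on k U (fun=> a).
Proof.
elim: k a => [|k IH] a; first by split=> // x _; exact: differentiable_cst.
rewrite Ck_onS; split=> [x _|v]; first exact: differentiable_cst.
rewrite (_ : 'D_v _ = fun=> 0); first exact: IH.
by apply/funext => x; rewrite derive_cst.
Qed.

Lemma smooth_on_cst W U (a : W) : smooth_on U (fun=> a).
Proof. by apply/smooth_onP => k; exact: Ck_on_cst. Qed.

Lemma smooth_on_id U : smooth_on U (@id V).
Proof.
apply/smooth_onP => -[|k]; first by split=> // x _; exact: (@ex_diff _ _ _ _ _ _ _ (is_diff_id x)).
rewrite Ck_onS; split=> [x _|v]; first exact: (@ex_diff _ _ _ _ _ _ _ (is_diff_id x)).
rewrite (_ : 'D_v id = fun=> v); first exact: Ck_on_cst.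
by apply/funext => x; rewrite derive_id.
Qed.

Lemma Ck_onD W k U (f g : V -> W) : open U ->
  Ck_on k U f -> Ck_on k U g -> Ck_on k U (fun x => f x + g x).
Proof.
move=> oU; elim: k f g => [|k IH] f g.
  by move=> [fd _] [gd _]; split=> // x Ux; apply: differentiableD; auto.
rewrite !Ck_onS => -[fd fD] [gd gD]; split=> [x Ux|v].
  by apply: differentiableD; auto.
apply: (eq_in_Ck_on oU _ (IH _ _ (fD v) (gD v))) => x; rewrite inE => Ux.
by rewrite [RHS]deriveD //; apply: diff_derivable; auto.
Qed.

Lemma smooth_onD W U (f g : V -> W) : open U ->
  smooth_on U f -> smooth_on U g -> smooth_on U (fun x => f x + g x).
Proof.
by move=> oU /smooth_onP fs /smooth_onP gs; apply/smooth_onP => k; exact: Ck_onD.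
Qed.

Lemma smooth_on_sum W U (I : Type) (r : seq I) (f : I -> V -> W) : open U ->
  (forall i, smooth_on U (f i)) -> smooth_on U (fun x => \sum_(i <- r) f i x).
Proof.
move=> oU fs; elim: r => [|i r IH].
  rewrite (_ : (fun _ => _) = fun=> 0); first exact: smooth_on_cst.
  by apply/funext => x; rewrite big_nil.
rewrite (_ : (fun _ => _) = fun x => f i x + \sum_(j <- r) f j x).
  exact: smooth_onD.
by apply/funext => x; rewrite big_cons.
Qed.

Lemma Ck_onZl W k U (f : V -> R) (a : W) :
  open U -> Ck_on k U f -> Ck_on k U (fun x => f x *: a).
Proof.
move=> oU; elim: k f => [|k IH] f.
  by move=> [fd _]; split=> // x Ux; apply: differentiableZl; auto.
rewrite !Ck_onS => -[fd fD]; split=> [x Ux|v].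
  by apply: differentiableZl; auto.
apply: (eq_in_Ck_on oU _ (IH _ (fD v))) => x; rewrite inE => Ux.
have dfa : differentiable (fun z => f z *: a) x by apply: differentiableZl; auto.
by rewrite [RHS]deriveE // diffZl ?deriveE; auto.
Qed.

Lemma smooth_onZl W U (f : V -> R) (a : W) :
  open U -> smooth_on U f -> smooth_on U (fun x => f x *: a).
Proof.
by move=> oU /smooth_onP fs; apply/smooth_onP => k; exact: Ck_onZl.
Qed.

Lemma Ck_onM k U (f g : V -> R) : open U ->
  Ck_on k U f -> Ck_on k U g -> Ck_on k U (fun x => f x * g x).
Proof.
move=> oU; elim: k f g => [|k IH] f g.
  by move=> [fd _] [gd _]; split=> // x Ux; apply: differentiableM; auto.
move=> fk gk; have /Ck_onS[fd fD] := fk; have /Ck_onS[gd gD] := gk; rewrite Ck_onS.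
split=> [x Ux|v]; first by apply: differentiableM; auto.
apply: (@eq_in_Ck_on _ _ _ (fun x => f x * 'D_v g x + g x * 'D_v f x)) => //.
  move=> x; rewrite inE => Ux.
  by rewrite [RHS]deriveM //; apply: diff_derivable; auto.
by apply: Ck_onD => //; apply: IH => //; exact: Ck_onW.
Qed.

Lemma smooth_onM U (f g : V -> R) : open U ->
  smooth_on U f -> smooth_on U g -> smooth_on U (fun x => f x * g x).
Proof.
by move=> oU /smooth_onP fs /smooth_onP gs; apply/smooth_onP => k; exact: Ck_onM.
Qed.

Lemma smooth_onN U (f : V -> R) : open U ->
  smooth_on U f -> smooth_on U (fun x => - f x).
Proof.
move=> oU fs; rewrite (_ : (fun _ => _) = fun x => (-1) * f x).
  by apply: smooth_onM => //; exact: smooth_on_cst.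
by apply/funext => x; rewrite mulN1r.
Qed.

Lemma smooth_onB U (f g : V -> R) : open U ->
  smooth_on U f -> smooth_on U g -> smooth_on U (fun x => f x - g x).
Proof. by move=> oU fs gs; apply: smooth_onD => //; exact: smooth_onN. Qed.

Lemma smooth_on_prod U (I : Type) (r : seq I) (f : I -> V -> R) : open U ->
  (forall i, smooth_on U (f i)) -> smooth_on U (fun x => \prod_(i <- r) f i x).
Proof.
move=> oU fs; elim: r => [|i r IH].
  rewrite (_ : (fun _ => _) = fun=> 1); first exact: smooth_on_cst.
  by apply/funext => x; rewrite big_nil.
rewrite (_ : (fun _ => _) = fun x => f i x * \prod_(j <- r) f j x).
  exact: smooth_onM.
by apply/funext => x; rewrite big_cons.
Qed.

Lemma smooth_on_inv U (f : V -> R) : open U -> (forall x, U x -> f x != 0) ->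
  smooth_on U f -> smooth_on U (fun x => (f x)^-1).
Proof.
move=> oU f0 /smooth_onP fs; apply/smooth_onP; elim=> [|k IH].
  by split=> // x Ux; apply: differentiableV; [exact: (Ck_on_differentiable (fs 0)) | exact: f0].
have fd x : U x -> differentiable f x by exact: (Ck_on_differentiable (fs 0)).
rewrite Ck_onS; split=> [x Ux|v]; first by apply: differentiableV; auto.
(* The derivative of the inverse contains the inverse itself only undifferentiated, so the induction
   hypothesis at order [k] suffices. *)
apply: (@eq_in_Ck_on _ _ _ (fun x => (- 'D_v f x) * ((f x)^-1 * (f x)^-1))) => //.
  move=> x; rewrite inE => Ux.
  rewrite [RHS]deriveV; [|exact: f0|exact/diff_derivable/fd].
  by rewrite /GRing.scale /= expr2 invfM; ring.
have [_ fD] := (Ck_onS k U f).1 (fs k.+1).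
apply: Ck_onM => //; last exact: Ck_onM.
rewrite (_ : (fun _ => _) = fun x => (-1) * 'D_v f x).
  by apply: Ck_onM => //; exact: Ck_on_cst.
by apply/funext => x; rewrite mulN1r.
Qed.

Lemma smooth_on_det p U (A : V -> 'M[R]_p) : open U ->
  (forall i j, smooth_on U (fun x => A x i j)) ->
  smooth_on U (fun x => \det (A x)).
Proof.
move=> oU As; rewrite /determinant; apply: smooth_on_sum => // s.
by apply: smooth_onM => //; [exact: smooth_on_cst | exact: smooth_on_prod].
Qed.

(** Cramer's rule: each entry of the inverse is a cofactor, polynomial in the entries, over the
    determinant. *)
Lemma smooth_on_invmx p U (A : V -> 'M[R]_p) : open U ->
  (forall x, U x -> A x \in unitmx) ->
  (forall i j, smooth_on U (fun x => A x i j)) ->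
  forall i j, smooth_on U (fun x => invmx (A x) i j).
Proof.
move=> oU Au As i j.
apply: (@eq_in_smooth_on _ U (fun x => (\det (A x))^-1 * \adj (A x) i j)) => //.
  by move=> x; rewrite inE => Ux; rewrite /invmx Au // !mxE.
apply: smooth_onM => //.
  apply: smooth_on_inv => //; last exact: smooth_on_det.
  by move=> x /Au; rewrite unitmxE unitfE.
rewrite (_ : (fun _ => _) = fun x => (-1) ^+ (j + i) * \det (row' j (col' i (A x)))).
  apply: smooth_onM => //; first exact: smooth_on_cst.
  apply: smooth_on_det => // k l.
  by rewrite (_ : (fun _ => _) = fun x => A x (lift j k) (lift i l)) //;
    apply/funext => x; rewrite !mxE.
by apply/funext => x; rewrite !mxE.
Qed.

End Smooth.

(** * Smoothness under continuous linear substitutions *)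

Section LinearSubstitution.
Context (R : realType) (V V' W : normedModType R) (L : {linear V' -> V}).
Context (cL : continuous L).

Lemma derive_comp_linear (f : V -> W) v x :
  'D_v (f \o L) x = 'D_(L v) f (L x).
Proof.
rewrite /derive.
by under [in LHS]eq_fun do rewrite /= linearP.
Qed.

Lemma smooth_on_comp_linear (U : set V) (f : V -> W) :
  smooth_on U f -> smooth_on (L @^-1` U) (f \o L).
Proof.
move=> /smooth_onP fs; apply/smooth_onP => k.
elim: k f {fs}(fs k) => [|k IH] f.
  move=> [fd _]; split=> // x Ux.
  exact: differentiable_comp (linear_differentiable x cL) (fd _ Ux).
rewrite !Ck_onS => -[fd fD]; split=> [x Ux|v].
  exact: differentiable_comp (linear_differentiable x cL) (fd _ Ux).
rewrite (_ : 'D_v (f \o L) = 'D_(L v) f \o L); first exact: IH.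
by apply/funext => x; rewrite derive_comp_linear.
Qed.

End LinearSubstitution.

(** * Symmetry of mixed directional derivatives *)

Section Schwarz.
Context (R : realType) (V : normedModType R).
Implicit Types (f : V -> R) (u v x : V) (U : set V).

Lemma MVT_line f x u (h : R) : 0 < h ->
  (forall s, 0 <= s <= h -> derivable f (s *: u + x) u) ->
  exists2 c, 0 <= c <= h & f (h *: u + x) - f x = 'D_u f (c *: u + x) * h.
Proof.
move=> h0 df; pose g (s : R) := f (s *: u + x).
(* The difference quotients of [g] along 1 and of [f] along [u] coincide, so derivability passes
   from [f] to [g]. *)
have quot s : (fun k : R => k^-1 *: ((g \o shift s) (k *: 1) - g s)) =
    (fun k : R => k^-1 *: ((f \o shift (s *: u + x)) (k *: u) - f (s *: u + x))).
  apply/funext => k /=; rewrite /g /=; congr (_ *: (f _ - _)).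
  by rewrite scalerDl addrA; congr (_ *: _ + _ + _); rewrite /GRing.scale /= mulr1.
have gd s : 0 <= s <= h -> is_derive s 1 g ('D_u f (s *: u + x)).
  move=> /df dfs; apply: DeriveDef; first by rewrite /derivable quot.
  by rewrite /derive quot.
have gc : {within `[0, h], continuous g}.
  apply: derivable_within_continuous => s; rewrite in_itv /= => /gd gs.
  exact: ex_derive.
have [|c] := MVT h0 _ gc (df := fun s => 'D_u f (s *: u + x)).
  by move=> s; rewrite in_itv /= => /andP[s0 sh]; apply: gd; rewrite !ltW.
rewrite in_itv /= => /andP[c0 ch] E; exists c; first by rewrite !ltW.
by move: E; rewrite /g scale0r add0r subr0.
Qed.

Lemma near_parallelogram x u v (P : set V) : nbhs x P ->
  exists2 h : R, 0 < h &
    forall s t, 0 <= s <= h -> 0 <= t <= h -> P (s *: u + (t *: v + x)).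
Proof.
move=> /nbhs_ballP[e /= e0 eP].
(* The summand 1 keeps [M] positive when [u] and [v] vanish; with side [e / 2 / M] the displacement
   has norm at most [e / 2]. *)
pose M := 1 + `|u| + `|v|.
have M0 : 0 < M by rewrite /M -addrA ltr_wpDr // addr_ge0.
exists (e / 2 / M) => [|s t /andP[s0 sh] /andP[t0 th]]; first by rewrite !divr_gt0.
apply: eP; rewrite -ball_normE /= addrA opprD addrCA subrr addr0 normrN.
have hM : e / 2 / M * (`|u| + `|v|) <= e / 2.
  rewrite -[leRHS](@divfK _ M) ?gt_eqF // ler_wpM2l ?divr_ge0 ?(ltW M0) ?(ltW e0) //.
  by rewrite /M; lra.
apply: (@le_lt_trans _ _ (e / 2)); last by lra.
apply: le_trans hM; rewrite mulrDr (le_trans (ler_normD _ _)) //.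
by rewrite !normrZ !ger0_norm // lerD // ler_wpM2r.
Qed.

(* Both mixed derivatives are limits of the same second difference quotient. *)
Lemma derive_mixed U f x u v : open U -> U x -> smooth_on U f ->
  'D_u ('D_v f) x = 'D_v ('D_u f) x.
Proof.
move=> oU Ux fs.
(* The mean value theorem is applied twice: along [y] to the increment of [f] by [h *: z], then
   along [z] to ['D_y f]. *)
have second y z (h : R) : 0 < h ->
    (forall s t : R, 0 <= s <= h -> 0 <= t <= h -> U (s *: y + (t *: z + x))) ->
    exists s t, [/\ 0 <= s <= h, 0 <= t <= h &
      f (h *: y + (h *: z + x)) - f (h *: z + x) - (f (h *: y + x) - f x)
      = 'D_z ('D_y f) (s *: y + (t *: z + x)) * (h * h)].
  move=> h0 hU.
  have h00 : 0 <= (0 : R) <= h by rewrite lexx ltW.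
  have hhh : 0 <= h <= h by rewrite lexx ltW.
  pose g w := f (h *: z + w) - f w.
  have dg s : 0 <= s <= h -> is_derive (s *: y + x) y g
      ('D_y f (h *: z + (s *: y + x)) - 'D_y f (s *: y + x)).
    move=> sh.
    have d1 : derivable f (s *: y + x) y.
      apply/diff_derivable/(smooth_on_differentiable fs).
      by have := hU s 0 sh h00; rewrite scale0r add0r.
    have d2 : derivable f (h *: z + (s *: y + x)) y.
      apply/diff_derivable/(smooth_on_differentiable fs).
      by rewrite addrCA; exact: hU.
    have q k : (f \o +%R (h *: z) \o shift (s *: y + x)) k =
        (f \o shift (h *: z + (s *: y + x))) k by rewrite /= addrCA.
    have d3 : is_derive (s *: y + x) y (f \o +%R (h *: z))
        ('D_y f (h *: z + (s *: y + x))).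
      apply: DeriveDef; rewrite /derivable /derive.
        by under eq_fun do rewrite q.
      by under eq_fun do rewrite q.
    exact: is_deriveB.
  have [s sh] := MVT_line h0 (fun s sh => @ex_derive _ _ _ _ _ _ _ (dg s sh)).
  rewrite (@derive_val _ _ _ _ _ _ _ (dg s sh)) /g addrCA => E0.
  have [t th E] := @MVT_line ('D_y f) (s *: y + x) z h h0
    (fun t th => diff_derivable (smooth_on_differentiable (smooth_on_derive y fs)
       (eq_ind _ U (hU s t sh th) _ (addrCA (s *: y) (t *: z) x)))).
  exists s, t; split=> //; rewrite [LHS](_ : _ = f (h *: y + (h *: z + x))
      - f (h *: y + x) - (f (h *: z + x) - f x)); last by ring.
  by rewrite E0 E (addrCA (t *: z)) -mulrA.
set A := 'D_u _ x; set B := 'D_v _ x.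
apply/eqP; rewrite -subr_eq0 -normr_eq0; apply/eqP/le_anti; rewrite normr_ge0 andbT.
apply/ler_addgt0Pr => e e0; rewrite add0r.
have close (a b c : R) : `|a - c| < e / 2 -> `|b - c| < e / 2 -> `|a - b| <= e.
  move=> ac bc; rewrite (splitr e) (le_trans (ler_distD c _ _)) // lerD ?(ltW ac) //.
  by rewrite distrC ltW.
have cont y z : {for x, continuous ('D_y ('D_z f))}.
  apply: differentiable_continuous; apply: (smooth_on_differentiable _ Ux).
  exact/smooth_on_derive/smooth_on_derive.
have e2 : 0 < e / 2 by rewrite divr_gt0.
have nA : \forall t \near x, `|A - 'D_u ('D_v f) t| < e / 2.
  by have /cvgrPdist_lt := cont u v; apply.
have nB : \forall t \near x, `|B - 'D_v ('D_u f) t| < e / 2.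
  by have /cvgrPdist_lt := cont v u; apply.
have [h h0 hP] := near_parallelogram u v
  (filterI (open_nbhs_nbhs (conj oU Ux)) (filterI nA nB)).
have hU s t : 0 <= s <= h -> 0 <= t <= h -> U (s *: u + (t *: v + x)).
  by move=> sh th; have [] := hP s t sh th.
have hU' s t : 0 <= s <= h -> 0 <= t <= h -> U (s *: v + (t *: u + x)).
  by move=> sh th; rewrite addrCA; exact: hU.
have [s [t [sh th E1]]] := second u v h h0 hU.
have [s' [t' [sh' th' E2]]] := second v u h h0 hU'.
have [_ [_ /= nB1]] := hP s t sh th.
have [_ [/= nA1 _]] := hP t' s' th' sh'.
(* The second difference is symmetric in [u] and [v], so one mixed derivative at one point near [x]
   equals the other at another such point. This common value is within [e / 2] of both [A] and
   [B]. *)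
have E : 'D_v ('D_u f) (s *: u + (t *: v + x)) = 'D_u ('D_v f) (t' *: u + (s' *: v + x)).
  have hh : h * h != 0 by rewrite mulf_neq0 // gt_eqF.
  apply: (mulIf hh); rewrite (addrCA (t' *: u)).
  apply: etrans E2; apply: (etrans (esym E1)).
  by rewrite (addrCA (h *: v)); ring.
rewrite -/A -/B in nA1 nB1; rewrite -E in nA1.
move: nA1 nB1; set c := 'D_v _ _ => nA1 nB1.
exact: close nA1 nB1.
Qed.

End Schwarz.

(** * Adapted coframe, Sasaki-Matsumoto metric and symmetries of the fundamental tensor *)

Section Spray.
Context (R : realType) (p : nat).
Local Notation V := 'rV[R]_(p + p).
Context (E : V -> R) (U : set V).
Implicit Types (w X Y : V) (a b c e : 'I_p).

Lemma hcoframe_linear a : scalar (@hcoframe R p a).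
Proof. by move=> k X Y; rewrite /hcoframe !mxE. Qed.

HB.instance Definition _ a :=
  GRing.isLinear.Build R V R *%R (@hcoframe R p a) (hcoframe_linear a).

Lemma vcoframe_linear w a : scalar (@vcoframe R p E w a).
Proof.
move=> k X Y; rewrite /vcoframe !mxE.
rewrite (eq_bigr (fun b => k * (nonlin_conn E a b w * lsubmx X 0 b)
  + nonlin_conn E a b w * lsubmx Y 0 b)) => [|b _].
  by rewrite big_split /= -mulr_sumr mulrDr addrACA.
by rewrite !mxE mulrDr mulrCA.
Qed.

HB.instance Definition _ w a :=
  GRing.isLinear.Build R V R *%R (@vcoframe R p E w a) (vcoframe_linear w a).

Lemma hcoframe_hframe w a b : hcoframe b (hframe E a w) = (b == a)%:R.
Proof. by rewrite /hcoframe /hframe row_mxKl !mxE eqxx. Qed.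

Lemma hcoframe_vframe w a b : hcoframe b (vframe a w) = 0 :> R.
Proof. by rewrite /hcoframe /vframe row_mxKl !mxE. Qed.

Lemma vcoframe_vframe w w' a b : vcoframe E w b (vframe a w') = (b == a)%:R.
Proof.
rewrite /vcoframe /vframe row_mxKl row_mxKr !mxE eqxx big1 ?addr0 // => i _.
by rewrite mxE mulr0.
Qed.

Lemma vcoframe_hframe w a b : vcoframe E w b (hframe E a w) = 0.
Proof.
rewrite /vcoframe /hframe row_mxKl row_mxKr (bigD1 a) //= big1 => [|i /negPf ia].
  by rewrite !mxE !eqxx mulr1 addr0 addNr.
by rewrite mxE ia andbF mulr0.
Qed.

(** The coframe is triangular: dx^a fixes the x-part, after which delta y^a fixes the y-part. Vector
    identities below are checked on it. *)
Lemma hvcoframe_inj w X Y : (forall a, hcoframe a X = hcoframe a Y) ->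
  (forall a, vcoframe E w a X = vcoframe E w a Y) -> X = Y.
Proof.
move=> hXY vXY; rewrite -[X]hsubmxK -[Y]hsubmxK.
have lE : lsubmx X = lsubmx Y by apply/rowP => a; exact: hXY.
congr row_mx => //; apply/rowP => a; have := vXY a.
by rewrite /vcoframe lE => /addIr.
Qed.

Lemma hcoframe_hproj w X a : hcoframe a (hproj E w X) = hcoframe a X.
Proof.
rewrite /hproj linear_sum /= (bigD1 a) //= big1 => [|i /negPf ia].
  by rewrite linearZ /= hcoframe_hframe eqxx mulr1 addr0.
by rewrite linearZ /= hcoframe_hframe eq_sym ia mulr0.
Qed.

Lemma vcoframe_vproj w X a : vcoframe E w a (vproj E w X) = vcoframe E w a X.
Proof.
rewrite /vproj linear_sum /= (bigD1 a) //= big1 => [|i /negPf ia].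
  by rewrite linearZ /= vcoframe_vframe eqxx mulr1 addr0.
by rewrite linearZ /= vcoframe_vframe eq_sym ia mulr0.
Qed.

Lemma horizontal_vcoframe (X : V -> V) w a :
  horizontal E U X -> U w -> vcoframe E w a (X w) = 0.
Proof.
move=> hX /hX [xi ->]; rewrite linear_sum big1 // => i _.
by rewrite linearZ /= vcoframe_hframe mulr0.
Qed.

Lemma vertical_hcoframe (X : V -> V) w a :
  vertical U X -> U w -> hcoframe a (X w) = 0.
Proof.
move=> vX /vX [xi ->]; rewrite linear_sum big1 // => i _.
by rewrite linearZ /= hcoframe_vframe mulr0.
Qed.

Lemma horizontal_hproj (X : V -> V) w : horizontal E U X -> U w ->
  X w = hproj E w (X w).
Proof.
move=> hX Uw; apply: (@hvcoframe_inj w) => a; first by rewrite hcoframe_hproj.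
rewrite (horizontal_vcoframe _ hX) // linear_sum big1 // => i _.
by rewrite linearZ /= vcoframe_hframe mulr0.
Qed.

Lemma vertical_vproj (X : V -> V) w : vertical U X -> U w ->
  X w = vproj E w (X w).
Proof.
move=> vX Uw; apply: (@hvcoframe_inj w) => a; last by rewrite vcoframe_vproj.
rewrite (vertical_hcoframe _ vX) // linear_sum big1 // => i _.
by rewrite linearZ /= hcoframe_vframe mulr0.
Qed.

Lemma horizontal_hframe a : horizontal E U (hframe E a).
Proof.
move=> w _; exists (fun b => (b == a)%:R).
rewrite (bigD1 a) //= big1 ?eqxx ?scale1r ?addr0 // => i /negPf ->.
by rewrite scale0r.
Qed.

Lemma vertical_vframe a : vertical U (@vframe R p a).
Proof.
move=> w _; exists (fun b => (b == a)%:R).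
rewrite (bigD1 a) //= big1 ?eqxx ?scale1r ?addr0 // => i /negPf ->.
by rewrite scale0r.
Qed.

Lemma sum_delta (f : 'I_p -> R) b : \sum_a f a * (a == b)%:R = f b.
Proof.
rewrite (bigD1 b) //= big1 ?eqxx ?mulr1 ?addr0 // => i /negPf ->.
by rewrite mulr0.
Qed.

(** Pairing with a frame vector lowers an index; this turns the metric condition into linear
    equations for the coefficients of nabla. *)
Lemma sasaki_matsumoto_v w X b :
  (forall a, hcoframe a X = 0) ->
  sasaki_matsumoto E w X (vframe b w)
  = \sum_a fund_tensor E w a b * vcoframe E w a X.
Proof.
move=> hX; apply: eq_bigr => a _; rewrite (bigD1 b) //= big1 => [|i /negPf ib].
  by rewrite hX mul0r add0r vcoframe_vframe eqxx mulr1 addr0.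
by rewrite hX mul0r add0r vcoframe_vframe ib !mulr0.
Qed.

Lemma sasaki_matsumoto_h w X b :
  (forall a, vcoframe E w a X = 0) ->
  sasaki_matsumoto E w X (hframe E b w)
  = \sum_a fund_tensor E w a b * hcoframe a X.
Proof.
move=> vX; apply: eq_bigr => a _; rewrite (bigD1 b) //= big1 => [|i /negPf ib].
  by rewrite vX mul0r addr0 hcoframe_hframe eqxx mulr1 addr0.
by rewrite vX mul0r addr0 hcoframe_hframe ib !mulr0.
Qed.

Lemma sasaki_matsumoto_vv w a b :
  sasaki_matsumoto E w (vframe a w) (vframe b w) = fund_tensor E w a b.
Proof.
rewrite sasaki_matsumoto_v => [|i]; last by rewrite hcoframe_vframe.
by under eq_bigr do rewrite vcoframe_vframe; rewrite sum_delta.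
Qed.

Lemma sasaki_matsumoto_hh w a b :
  sasaki_matsumoto E w (hframe E a w) (hframe E b w) = fund_tensor E w a b.
Proof.
rewrite sasaki_matsumoto_h => [|i]; last by rewrite vcoframe_hframe.
by under eq_bigr do rewrite hcoframe_hframe; rewrite sum_delta.
Qed.

Context (oU : open U).
Context (sE : smooth_on U E).

Lemma fund_tensorC w a b : U w -> fund_tensor E w a b = fund_tensor E w b a.
Proof. by move=> Uw; rewrite !mxE /dy (derive_mixed _ _ oU Uw). Qed.

Lemma sasaki_matsumotoC w X Y : U w ->
  sasaki_matsumoto E w X Y = sasaki_matsumoto E w Y X.
Proof.
move=> Uw; rewrite /sasaki_matsumoto exchange_big; apply: eq_bigr => a _.
apply: eq_bigr => b _; rewrite fund_tensorC //.
by rewrite (mulrC (hcoframe b X)) (mulrC (vcoframe E w b X)).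
Qed.

Lemma fund_tensorE a b :
  (fun w => fund_tensor E w a b) = 2%:R^-1 *: dy (dy E b) a.
Proof. by apply/funext => w; rewrite mxE. Qed.

Lemma smooth_fund_tensor a b : smooth_on U (fun w => fund_tensor E w a b).
Proof.
rewrite fund_tensorE; apply: (@smooth_onM _ _ U (fun=> 2%:R^-1)) => //.
  exact: smooth_on_cst.
by apply: smooth_on_derive; apply: smooth_on_derive.
Qed.


(** Schwarz for [dy E b]. With the symmetry of g_ab it makes the third y-derivatives of [E] totally
    symmetric. *)
Lemma dy_fund_tensor_swap w a b e : U w ->
  dy (fun w => fund_tensor E w a b) e w = dy (fun w => fund_tensor E w e b) a w.
Proof.
move=> Uw; rewrite !fund_tensorE /dy.
have sEb := smooth_on_derive (row_mx 0 (delta_mx 0 b)) sE.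
have d v u : derivable ('D_v (dy E b)) w u.
  exact/diff_derivable/(smooth_on_differentiable (smooth_on_derive v sEb)).
apply: etrans (deriveZ _ (d _ _)) _; apply: etrans _ (esym (deriveZ _ (d _ _))).
exact: congr1 (derive_mixed (row_mx 0 (delta_mx 0 e)) (row_mx 0 (delta_mx 0 a)) oU Uw sEb).
Qed.

Lemma eq_in_delta_deriv (f g : V -> R) a w : {in U, f =1 g} -> U w ->
  delta_deriv E f a w = delta_deriv E g a w.
Proof.
move=> fg Uw; have Uw' : w \in U by rewrite inE.
rewrite /delta_deriv; congr (_ - _); first exact: (eq_in_derive _ oU fg).
by apply: eq_bigr => b _; congr (_ * _); exact: (eq_in_derive _ oU fg).
Qed.

Lemma delta_deriv_fund_tensorC w a b e : U w ->
  delta_deriv E (fun w => fund_tensor E w a b) e w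
  = delta_deriv E (fun w => fund_tensor E w b a) e w.
Proof.
by apply: eq_in_delta_deriv => z; rewrite inE; exact: fund_tensorC.
Qed.

Lemma dy_fund_tensorC w a b e : U w ->
  dy (fun w => fund_tensor E w a b) e w = dy (fun w => fund_tensor E w b a) e w.
Proof.
move=> Uw; apply: (eq_in_derive _ oU); last by rewrite inE.
by move=> z; rewrite inE; exact: fund_tensorC.
Qed.

Context (gU : forall w, U w -> fund_tensor E w \in unitmx).

Lemma smooth_nonlin_conn a b : smooth_on U (nonlin_conn E a b).
Proof.
apply: smooth_on_derive; apply: smooth_onM => //; first exact: smooth_on_cst.
apply: smooth_on_sum => // e; apply: smooth_onM => //.
  by apply: smooth_on_invmx => // i j; exact: smooth_fund_tensor.
apply: smooth_onB => //; last exact: smooth_on_derive.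
apply: smooth_on_sum => // c; apply: smooth_onM => //.
  by apply: smooth_on_derive; apply: smooth_on_derive.
(* The coordinate y^c is the identity of [R] composed with a continuous linear map, packed as [L] to
   fit [smooth_on_comp_linear]. *)
have cs : continuous (fun w : V => rsubmx w 0 c : R).
  move=> w; apply: differentiable_continuous.
  apply: (@differentiable_comp _ _ _ _ rsubmx (fun z : 'rV[R]_p => z 0 c)).
    exact: differentiable_rsubmx.
  exact: differentiable_coord.
have ls : linear (fun w : V => rsubmx w 0 c : R) by move=> k X Y; rewrite !mxE.
pose lsM := GRing.isLinear.Build R V R _ _ ls.
pose L : {linear V -> R} := HB.pack (fun w : V => rsubmx w 0 c : R) lsM.
apply: (@smooth_on_sub _ _ _ _ setT) => //.
by apply: (@smooth_on_comp_linear _ _ _ _ L cs setT id); apply: smooth_on_id.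
Qed.

End Spray.

(** * Smoothness and brackets of the adapted frame, and the algebra of lowered indices *)

Section Frames.
Context (R : realType) (p : nat).
Local Notation V := 'rV[R]_(p + p).
Context (E : V -> R) (U : set V).
Implicit Types (w X Y : V) (a b c e : 'I_p).

Lemma hframeE a w : hframe E a w =
  row_mx (delta_mx 0 a) 0 + \sum_b (- nonlin_conn E b a w) *: vframe b w.
Proof.
apply: (@hvcoframe_inj _ _ E w) => b.
  rewrite hcoframe_hframe linearD linear_sum big1 => [|i _].
    by rewrite addr0 /= /hcoframe row_mxKl !mxE eqxx.
  by rewrite linearZ /= hcoframe_vframe mulr0.
rewrite vcoframe_hframe linearD linear_sum /=.
under eq_bigr do rewrite linearZ /= vcoframe_vframe eq_sym.
rewrite sum_delta /vcoframe row_mxKl row_mxKr (bigD1 a) //= big1 => [|i /negPf ia].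
  by rewrite !mxE !eqxx mulr1 addr0 add0r subrr.
by rewrite mxE ia andbF mulr0.
Qed.

Lemma derive_hframe (f : V -> R) a w : differentiable f w ->
  'D_(hframe E a w) f w = delta_deriv E f a w.
Proof.
move=> df; rewrite hframeE /delta_deriv /dx /dy !deriveE // linearD linear_sum /=.
congr (_ + _); rewrite -sumrN; apply: eq_bigr => b _.
by rewrite linearZ /= -mulNr; congr (_ * _); rewrite deriveE.
Qed.

Lemma smooth_vframe a : smooth_on U (@vframe R p a).
Proof. exact: smooth_on_cst. Qed.

Context (oU : open U).
Context (sE : smooth_on U E).
Context (gU : forall w, U w -> fund_tensor E w \in unitmx).

Lemma smooth_hframe a : smooth_on U (hframe E a).
Proof.
rewrite (_ : hframe E a = fun w => row_mx (delta_mx 0 a) 0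
    + \sum_b (- nonlin_conn E b a w) *: row_mx 0 (delta_mx 0 b)); last first.
  by apply/funext => w; exact: hframeE.
apply: smooth_onD => //; first exact: smooth_on_cst.
apply: smooth_on_sum => // b; apply: smooth_onZl => //; apply: smooth_onN => //.
exact: smooth_nonlin_conn.
Qed.

Lemma derive_vframe v a w : 'D_v (@vframe R p a) w = 0.
Proof. exact: derive_cst. Qed.

(** The x-part of [hframe] is constant, so only the nonlinear connection is differentiated. This is
    why all brackets of frame fields are vertical. *)
Lemma derive_of_hframe v a w : U w ->
  'D_v (hframe E a) w = row_mx 0 (- \row_b 'D_v (nonlin_conn E b a) w).
Proof.
move=> Uw; rewrite derive_mx; last first.
  exact/diff_derivable/(smooth_on_differentiable (smooth_hframe a)).
apply/rowP => j; rewrite [LHS]mxE; have [k ->|k ->] := split_ordP j.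
  rewrite row_mxEl mxE.
  rewrite (_ : (fun _ => _) = fun=> (delta_mx 0 a : 'rV[R]_p) 0 k) ?derive_cst //.
  by apply/funext => z; rewrite /hframe row_mxEl.
rewrite row_mxEr 2!mxE (_ : (fun _ => _) = - nonlin_conn E k a).
  rewrite deriveN //.
  exact/diff_derivable/(smooth_on_differentiable (smooth_nonlin_conn oU sE gU _ _)).
by apply/funext => z; rewrite /hframe row_mxEr !mxE.
Qed.

(** As [vframe] is constant, only the derivative of [hframe] along [vframe b] remains; its sign in
    the bracket cancels the minus sign in [hframe]. *)
Lemma lie_bracket_hv a b w : U w ->
  lie_bracket (hframe E a) (vframe b) w = \sum_c berwald E c a b w *: vframe c w.
Proof.
move=> Uw; rewrite /lie_bracket derive_vframe sub0r derive_of_hframe //.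
apply: (@hvcoframe_inj _ _ E w) => c.
  rewrite linear_sum big1 => [|i _].
    by rewrite linearN /= /hcoframe row_mxKl mxE oppr0.
  by rewrite linearZ /= hcoframe_vframe mulr0.
rewrite linear_sum /=.
under eq_bigr do rewrite linearZ /= vcoframe_vframe eq_sym.
rewrite sum_delta linearN /= /vcoframe row_mxKl row_mxKr big1 => [|i _].
  by rewrite !mxE addr0 opprK.
by rewrite mxE mulr0.
Qed.

Lemma lie_bracket_vv a b w : lie_bracket (@vframe R p a) (vframe b) w = 0.
Proof. by rewrite /lie_bracket !derive_vframe subr0. Qed.

Lemma hcoframe_lie_bracket_hh a b c w : U w ->
  hcoframe c (lie_bracket (hframe E a) (hframe E b) w) = 0.
Proof.
move=> Uw; have E1 := congr2 (fun X Y : V => X - Y)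
  (derive_of_hframe (hframe E a w) b Uw) (derive_of_hframe (hframe E b w) a Uw).
apply: etrans (congr1 (hcoframe c) E1) _.
by rewrite opp_row_mx add_row_mx /hcoframe row_mxKl subrr mxE.
Qed.

Lemma fund_tensor_inj w (x y : 'I_p -> R) : U w ->
  (forall c, \sum_d fund_tensor E w c d * x d = \sum_d fund_tensor E w c d * y d) ->
  x =1 y.
Proof.
move=> Uw xy d.
have E1 : fund_tensor E w *m \col_i x i = fund_tensor E w *m \col_i y i.
  apply/colP => c; rewrite ![LHS]mxE ![RHS]mxE.
  under eq_bigr do rewrite [X in _ * X]mxE.
  by under [RHS]eq_bigr do rewrite [X in _ * X]mxE.
have := congr1 (mulmx (invmx (fund_tensor E w))) E1.
by rewrite !mulKmx ?gU // => /colP/(_ d); rewrite !mxE.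
Qed.

Lemma fund_invK w (y : 'I_p -> R) c : U w ->
  \sum_d fund_tensor E w c d * (\sum_e fund_inv E w d e * y e) = y c.
Proof.
move=> Uw; have := mulKVmx (gU Uw) (\col_i y i) => /colP/(_ c).
rewrite !mxE => E1; rewrite -[RHS]E1; apply: eq_bigr => d _; congr (_ * _).
by rewrite mxE; apply: eq_bigr => e _; rewrite !mxE.
Qed.

Lemma fund_tensor_cartan w a b c : U w ->
  \sum_d fund_tensor E w c d * cartan E d a b w
  = 2%:R^-1 * dy (fun w' => fund_tensor E w' a b) c w.
Proof.
move=> Uw; rewrite /cartan; under eq_bigr do rewrite mulrCA.
by rewrite -mulr_sumr fund_invK.
Qed.

(** Here [K a b c] stands for G(nabla_a e_b, e_c) and [D a b c] for the derivative of G(e_b, e_c)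
    along e_a. The hypotheses are metric compatibility and torsion-freeness for frame fields whose
    bracket does not contribute. *)
Lemma koszul (D K : 'I_p -> 'I_p -> 'I_p -> R) :
  (forall a b c, D a b c = K a b c + K a c b) -> (forall a b c, K a b c = K b a c) ->
  forall a b c, K a b c = 2%:R^-1 * (D a b c + D b a c - D c a b).
Proof.
move=> DK KC a b c; rewrite !DK (KC b a) (KC c a) (KC c b); lra.
Qed.

End Frames.

(** * The Vaisman connection on the adapted frame, for a smooth energy with invertible fundamental
    tensor *)

Section Vaisman.
Context (R : realType) (m n : nat) (M1 : manifold R m) (M2 : manifold R n).
Local Notation p := (m + n)%N.
Local Notation V := 'rV[R]_(p + p).
Context (F : tangent M1 * tangent M2 -> R)
  (nabla : chart (slit_atlas M1 M2) -> (V -> V) -> (V -> V) -> V -> V)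
  (nablaV : vaisman_connection F nabla) (chi : chart (slit_atlas M1 M2)).
Local Notation U := (chart_image chi).
Local Notation E := (energy F chi).
Context (oU : open U) (sE : smooth_on U E)
  (gU : forall w, U w -> fund_tensor E w \in unitmx).
Implicit Types (w : V) (a b c d : 'I_p).

Let sh a : smooth_on U (hframe E a) := smooth_hframe oU sE gU a.
Let sv a : smooth_on U (@vframe R p a) := @smooth_vframe R p U a.
Let Hh a : horizontal E U (hframe E a) := @horizontal_hframe R p E U a.
Let Vv a : vertical U (@vframe R p a) := @vertical_vframe R p U a.

Let subrr_eq0 (x y z : R) : x - y - z = 0 -> x = y + z.
Proof. by move=> /eqP; rewrite -addrA -opprD subr_eq0 => /eqP. Qed.

(** In the vertical part of T(h_a, v_b) the term nabla_{v_b} h_a drops out, being horizontal, and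
    nabla_{h_a} v_b is already vertical. *)
Lemma vaisman_hv w a b : U w ->
  nabla chi (hframe E a) (vframe b) w = \sum_c berwald E c a b w *: vframe c w.
Proof.
move=> Uw; have Vn := vaisman_vertical nablaV (sh a) (sv b) (Vv b).
have Hn := vaisman_horizontal nablaV (sv b) (sh a) (Hh a).
rewrite [LHS](vertical_vproj E Vn Uw); apply: eq_bigr => c _; congr (_ *: _).
have /(congr1 (vcoframe E w c)) :=
  vaisman_torsion_v nablaV (sh a) (sv b) (or_intror (Vv b)) Uw.
rewrite vcoframe_vproj linear0 /torsion linearB linearB /=.
rewrite (horizontal_vcoframe _ Hn Uw) subr0 (lie_bracket_hv oU sE gU) // => /eqP.
rewrite subr_eq0 => /eqP ->; rewrite linear_sum /=.
by under eq_bigr do rewrite linearZ /= vcoframe_vframe eq_sym; rewrite sum_delta.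
Qed.

(** In the horizontal part of the same torsion, nabla_{h_a} v_b and the bracket both drop out, being
    vertical. *)
Lemma vaisman_vh w a b : U w -> nabla chi (vframe b) (hframe E a) w = 0.
Proof.
move=> Uw; have Vn := vaisman_vertical nablaV (sh a) (sv b) (Vv b).
have Hn := vaisman_horizontal nablaV (sv b) (sh a) (Hh a).
apply: (@hvcoframe_inj _ _ E w) => c; rewrite linear0; last first.
  exact: horizontal_vcoframe Hn Uw.
have /(congr1 (hcoframe c)) :=
  vaisman_torsion_h nablaV (sh a) (sv b) (or_introl (Hh a)) Uw.
rewrite hcoframe_hproj linear0 /torsion linearB linearB /=.
rewrite (vertical_hcoframe _ Vn Uw) (lie_bracket_hv oU sE gU) // linear_sum.
rewrite [X in _ - X]big1 => [|i _]; last by rewrite linearZ /= hcoframe_vframe mulr0.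
by rewrite sub0r subr0 => /eqP; rewrite oppr_eq0 => /eqP.
Qed.

Lemma vaisman_vv w a b : U w ->
  nabla chi (vframe a) (vframe b) w = \sum_c cartan E c a b w *: vframe c w.
Proof.
move=> Uw.
(* [K] is the coefficient of nabla with its upper index lowered and [D] the derivative of the
   metric: the data for [koszul]. *)
pose K i j k := \sum_d fund_tensor E w k d *
  vcoframe E w d (nabla chi (vframe i) (vframe j) w).
pose D i j k := dy (fun w' => fund_tensor E w' j k) i w.
have Vn i j := vaisman_vertical nablaV (sv i) (sv j) (Vv j).
rewrite [LHS](vertical_vproj E (Vn a b) Uw); apply: eq_bigr => e _; congr (_ *: _).
have KG i j k : K i j k = sasaki_matsumoto E w (nabla chi (vframe i) (vframe j) w) (vframe k w).
  rewrite sasaki_matsumoto_v => [|d]; last exact: vertical_hcoframe (Vn i j) Uw.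
  by apply: eq_bigr => d _; rewrite (fund_tensorC oU sE).
(* The metric condition on three frame fields; symmetry of the metric brings its last term to the
   form of [K]. *)
have DK i j k : D i j k = K i j k + K i k j.
  apply: etrans _ (congr2 +%R (esym (KG i j k))
    (etrans (sasaki_matsumotoC oU sE _ _ Uw) (esym (KG i k j)))).
  apply: etrans (subrr_eq0 (vaisman_metric nablaV (sv i) (sv j) (sv k)
    (or_introl (And3 (Vv i) (Vv j) (Vv k))) Uw)).
  rewrite /D /dy (_ : (fun w' => fund_tensor E w' j k) =
      fun w' => sasaki_matsumoto E w' (vframe j w') (vframe k w')) //.
  by apply/funext => z; rewrite sasaki_matsumoto_vv.
have KC i j k : K i j k = K j i k.
  rewrite /K; apply: eq_bigr => d _; congr (_ * _).
  have /(congr1 (vcoframe E w d)) :=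
    vaisman_torsion_v nablaV (sv i) (sv j) (or_introl (Vv i)) Uw.
  rewrite vcoframe_vproj linear0 /torsion lie_bracket_vv subr0 linearB /= => /eqP.
  by rewrite subr_eq0 => /eqP.
apply: (fund_tensor_inj gU Uw
  (x := fun c => vcoframe E w c (nabla chi (vframe a) (vframe b) w))
  (y := fun c => cartan E c a b w)) => c.
rewrite (fund_tensor_cartan gU) // -/(K a b c) (koszul DK KC); congr (_ * _).
(* By total symmetry all three terms of Koszul's formula equal [D c a b], and one copy survives. *)
have -> : D b a c = D a b c by rewrite /D (dy_fund_tensor_swap oU sE).
have -> : D a b c = D c a b.
  by rewrite /D (dy_fund_tensorC oU sE) // (dy_fund_tensor_swap oU sE).
by rewrite addrK.
Qed.

(** The delta-derivatives of g_ab need not be totally symmetric, so all three Koszul terms stay; up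
    to the symmetry of g_ab they are the bracket in [chern]. *)
Lemma vaisman_hh w a b : U w ->
  nabla chi (hframe E a) (hframe E b) w = \sum_c chern E c a b w *: hframe E c w.
Proof.
move=> Uw.
have Hn i j := vaisman_horizontal nablaV (sh i) (sh j) (Hh j).
rewrite [LHS](horizontal_hproj (Hn a b) Uw); apply: eq_bigr => c _; congr (_ *: _).
pose K i j k := \sum_d fund_tensor E w k d *
  hcoframe d (nabla chi (hframe E i) (hframe E j) w).
pose D i j k := delta_deriv E (fun w' => fund_tensor E w' j k) i w.
have KG i j k :
    K i j k = sasaki_matsumoto E w (nabla chi (hframe E i) (hframe E j) w) (hframe E k w).
  rewrite sasaki_matsumoto_h => [|d]; last exact: horizontal_vcoframe (Hn i j) Uw.
  by apply: eq_bigr => d _; rewrite (fund_tensorC oU sE).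
have DK i j k : D i j k = K i j k + K i k j.
  apply: etrans _ (congr2 +%R (esym (KG i j k))
    (etrans (sasaki_matsumotoC oU sE _ _ Uw) (esym (KG i k j)))).
  apply: etrans (subrr_eq0 (vaisman_metric nablaV (sh i) (sh j) (sh k)
    (or_intror (And3 (Hh i) (Hh j) (Hh k))) Uw)).
  rewrite /D -derive_hframe; last first.
    exact: smooth_on_differentiable (smooth_fund_tensor oU sE _ _) Uw.
  rewrite (_ : (fun w' => fund_tensor E w' j k) =
      fun w' => sasaki_matsumoto E w' (hframe E j w') (hframe E k w')) //.
  by apply/funext => z; rewrite sasaki_matsumoto_hh.
(* The bracket of two horizontal frame fields may be nonzero, but it is vertical and the horizontal
   torsion condition does not see it. *)
have HC i j d : hcoframe d (nabla chi (hframe E i) (hframe E j) w)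
    = hcoframe d (nabla chi (hframe E j) (hframe E i) w).
  have /(congr1 (hcoframe d)) :=
    vaisman_torsion_h nablaV (sh i) (sh j) (or_introl (Hh i)) Uw.
  rewrite hcoframe_hproj linear0 /torsion.
  rewrite linearB linearB /=.
  rewrite (hcoframe_lie_bracket_hh oU sE gU i j d Uw).
  by rewrite subr0 => /subr0_eq.
have KC i j k : K i j k = K j i k.
  exact: eq_bigr (fun d _ => congr1 _ (HC i j d)).
have KE := koszul DK KC.
apply: (fund_tensor_inj gU Uw
  (x := fun c => hcoframe c (nabla chi (hframe E a) (hframe E b) w))
  (y := fun c => chern E c a b w)) => e.
rewrite -/(K a b e) KE /chern.
under [RHS]eq_bigr do rewrite mulrCA.
rewrite -mulr_sumr; congr (_ * _); rewrite (fund_invK gU) // /D.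
rewrite (delta_deriv_fund_tensorC oU sE b e) // (delta_deriv_fund_tensorC oU sE a e) //.
by rewrite [in RHS](addrC (delta_deriv _ _ b w)).
Qed.

End Vaisman.

(** * Charts of a single manifold and the energy of a Finsler metric in them *)

Section Charts.
Context (R : realType).

(** The matrix norm is a maximum over finitely many entries, so [filter_forall] merges the entrywise
    neighbourhoods. *)
Lemma continuous_mx (T : topologicalType) (k l : nat) (f : T -> 'M[R]_(k, l)) :
  (forall i j, continuous (fun x => f x i j)) -> continuous f.
Proof.
move=> fc x; apply/cvgrPdist_le => /= e e0; near=> y.
rewrite /Num.Def.normr /= mx_normrE (bigmax_le _ (ltW e0)) //= => i _.
rewrite !mxE; move: i; near: y; apply: filter_forall => /= i.
by move/cvgrPdist_le : (fc i.1 i.2 x); apply.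
Unshelve. all: by end_near. Qed.

Lemma continuous_row_mx (T : topologicalType) (k l1 l2 : nat)
    (f : T -> 'M[R]_(k, l1)) (g : T -> 'M[R]_(k, l2)) :
  continuous f -> continuous g -> continuous (fun x => row_mx (f x) (g x)).
Proof.
move=> fc gc; apply: continuous_mx => i j.
have [a ->|a ->] := split_ordP j.
  rewrite (_ : (fun _ => _) = (fun A : 'M[R]_(k, l1) => A i a) \o f).
    by move=> x; apply: continuous_comp; [exact: fc | exact: coord_continuous].
  by apply/funext => x; rewrite row_mxEl.
rewrite (_ : (fun _ => _) = (fun A : 'M[R]_(k, l2) => A i a) \o g).
  by move=> x; apply: continuous_comp; [exact: gc | exact: coord_continuous].
by apply/funext => x; rewrite row_mxEr.
Qed.

Section OneManifold.
Context (n : nat) (M : manifold R n) (c : chart (atlas_of M)).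

(** Openness is postulated for overlaps; the self-overlap carries it over to chart images. *)
Lemma chart_image_overlap : chart_image c = overlap c c.
Proof. by rewrite /chart_image /overlap setIid. Qed.

Lemma chart_image_open : open (chart_image c).
Proof. by rewrite chart_image_overlap; exact: overlap_open (atlas_ofP M) c c. Qed.

Lemma chart_imageP x : chart_image c x ->
  dom c (Defs.point c x) /\ Defs.coord c (Defs.point c x) = x.
Proof. by case=> q cq <-; rewrite (coordK (atlas_ofP M) cq). Qed.

Lemma tcomp_tvec x y : chart_image c x -> tcomp (tvec c x y) c = y.
Proof.
move=> cx; have [dx ex] := chart_imageP cx.
rewrite /= /tvec_comp asboolT //.
have E1 : {in chart_image c, transition c c =1 id}.
  by move=> z; rewrite inE => /chart_imageP[].
by rewrite (eq_in_derive y chart_image_open E1) ?inE // derive_id.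
Qed.


Lemma slit_image_open : open (@slit_image _ _ M c).
Proof.
rewrite (_ : @slit_image _ _ M c =
    lsubmx @^-1` chart_image c `&` rsubmx @^-1` (~` [set 0])); last first.
  by apply/seteqP; split=> w [cw /eqP w0].
apply: openI; apply: open_comp.
- by move=> w _; exact: continuous_lsubmx.
- exact: chart_image_open.
- by move=> w _; exact: continuous_rsubmx.
- apply: closed_openC; apply: accessible_closed_set1.
  exact/hausdorff_accessible/norm_hausdorff.
Qed.

Context (F : tangent M -> R) (hF : is_finsler F).
Local Notation E := (fun w => local_expr F c w ^+ 2).
Local Notation S := (@slit_image _ _ M c).

Lemma smooth_local_expr_sqr : smooth_on S E.
Proof.
rewrite (_ : E = fun w => local_expr F c w * local_expr F c w).
  apply: smooth_onM; [exact: slit_image_open| |]; exact: finsler_smooth.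
by apply/funext => w; rewrite expr2.
Qed.

(** A nonzero vector in the left kernel would make the positive definite form vanish. *)
Lemma finsler_unitmx w : S w -> fund_tensor E w \in unitmx.
Proof.
move=> Sw; rewrite unitmxE unitfE; apply/det0P => -[xi xi0 gxi].
have := finsler_posdef hF Sw xi0; rewrite exchange_big /= big1 ?ltxx // => b _.
rewrite -mulr_suml; have /rowP/(_ b) := gxi; rewrite !mxE.
by under eq_bigr do rewrite mulrC; move=> ->; rewrite mul0r.
Qed.

Lemma smooth_fun_slit (f : M -> R) : smooth_fun f ->
  smooth_on S (fun w => f (Defs.point c (lsubmx w)) ^+ 2).
Proof.
move=> /(_ c) fs; rewrite (_ : (fun _ => _) = fun w : 'rV[R]_(n + n) =>
  ((f \o Defs.point c) \o lsubmx) w * ((f \o Defs.point c) \o lsubmx) w).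
  have fl : smooth_on S ((f \o Defs.point c) \o lsubmx).
    apply: (@smooth_on_sub _ _ _ _ (lsubmx @^-1` chart_image c)); first by move=> w [].
    by apply: smooth_on_comp_linear fs; exact: continuous_lsubmx.
  by apply: smooth_onM => //; exact: slit_image_open.
by apply/funext => w; rewrite expr2.
Qed.

End OneManifold.
End Charts.

(** * Derivatives along a direction in which the coefficients are constant *)

Section Slices.
Context (R : realType) (V V' : normedModType R) (P : {linear V -> V'}).

(** On the line through [w] along [v] the difference quotient is [a w] times that of [g]. In fibre
    directions [a] will be a warp factor and [b] the energy term of the other manifold. *)
Lemma derive_slice (a b : V -> R) (g : V' -> R) v w :
  (forall k, a (k *: v + w) = a w) -> (forall k, b (k *: v + w) = b w) ->
  derivable g (P w) (P v) ->
  'D_v (fun z => a z * g (P z) + b z) w = a w * 'D_(P v) g (P w).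
Proof.
move=> av bv dg; apply: etrans _ (deriveZ (a w) dg).
apply: (congr1 (fun q : R -> R => lim (q @ 0^'))); apply/funext => k /=.
by rewrite av bv [a w * g (P w) + b w]addrC addrKA -mulrBr linearP -scalerBr.
Qed.

End Slices.

(** * Induced charts of the product and block structure of the warped fundamental tensor *)

Section SlitChart.
Context (R : realType) (m n : nat) (M1 : manifold R m) (M2 : manifold R n).
Local Notation p := (m + n)%N.
Local Notation V := 'rV[R]_(p + p).
Context (c : chart (slit_atlas M1 M2)).
Local Notation U := (chart_image c).
Local Notation S1 := (@slit_image _ _ M1 c.1).
Local Notation S2 := (@slit_image _ _ M2 c.2).
Local Notation part1 := (@part1 R m n).
Local Notation part2 := (@part2 R m n).
Local Notation L := (@lshift m n).
Local Notation H := (@rshift m n).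

Lemma part1_linear : linear part1.
Proof. by move=> k X Y; rewrite /part1 !linearP scale_row_mx add_row_mx. Qed.
HB.instance Definition _ := GRing.isLinear.Build R V 'rV[R]_(m + m) _ part1 part1_linear.

Lemma part2_linear : linear part2.
Proof. by move=> k X Y; rewrite /part2 !linearP scale_row_mx add_row_mx. Qed.
HB.instance Definition _ := GRing.isLinear.Build R V 'rV[R]_(n + n) _ part2 part2_linear.

Lemma continuous_part1 : continuous part1.
Proof.
apply: continuous_row_mx => w; apply: continuous_comp.
- exact: continuous_lsubmx.
- exact: continuous_lsubmx.
- exact: continuous_rsubmx.
- exact: continuous_lsubmx.
Qed.

Lemma continuous_part2 : continuous part2.
Proof.
apply: continuous_row_mx => w; apply: continuous_comp.
- exact: continuous_lsubmx.
- exact: continuous_rsubmx.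
- exact: continuous_rsubmx.
- exact: continuous_rsubmx.
Qed.

Lemma slit_chartP w : U w <-> S1 (part1 w) /\ S2 (part2 w).
Proof.
rewrite /slit_image /part1 /part2 /= !row_mxKl !row_mxKr; split.
  move=> [[v1 v2] [/= d1 d2 n1 n2] <-]; rewrite row_mxKl row_mxKr.
  rewrite !row_mxKl !row_mxKr.
  by split; split=> //; [exists (base v1) | exists (base v2)].
(* The point is the pair of tangent vectors built from the parts of [w]; [tcomp_tvec] recovers their
   components in [c]. *)
move=> [[c1 n1] [c2 n2]]; exists (Defs.point c w).
  split.
  - by have [] := chart_imageP c1.
  - by have [] := chart_imageP c2.
  - by rewrite [X in X != _](tcomp_tvec _ c1).
  - by rewrite [X in X != _](tcomp_tvec _ c2).
rewrite -[RHS]hsubmxK; congr row_mx; rewrite -[RHS]hsubmxK; congr row_mx.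
- by have [] := chart_imageP c1.
- by have [] := chart_imageP c2.
- exact: tcomp_tvec.
- exact: tcomp_tvec.
Qed.

Lemma slit_chart_imageE : U = part1 @^-1` S1 `&` part2 @^-1` S2.
Proof. by apply/seteqP; split=> w /slit_chartP. Qed.

Lemma slit_chart_open : open U.
Proof.
rewrite slit_chart_imageE; apply: openI; apply: open_comp.
- by move=> w _; exact: continuous_part1.
- exact: slit_image_open.
- by move=> w _; exact: continuous_part2.
- exact: slit_image_open.
Qed.

Lemma smooth_on_part1 (g : 'rV[R]_(m + m) -> R) :
  smooth_on S1 g -> smooth_on U (g \o part1).
Proof.
move=> /(smooth_on_comp_linear continuous_part1); apply: smooth_on_sub.
by move=> w /slit_chartP[].
Qed.

Lemma smooth_on_part2 (g : 'rV[R]_(n + n) -> R) :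
  smooth_on S2 g -> smooth_on U (g \o part2).
Proof.
move=> /(smooth_on_comp_linear continuous_part2); apply: smooth_on_sub.
by move=> w /slit_chartP[].
Qed.

Lemma part1_dy1 j : part1 (row_mx 0 (delta_mx 0 (L j))) = row_mx 0 (delta_mx 0 j).
Proof.
rewrite /part1 row_mxKl row_mxKr linear0; congr row_mx.
by apply/rowP => i; rewrite !mxE (inj_eq (@lshift_inj _ _)).
Qed.

Lemma part1_dy2 j : part1 (row_mx 0 (delta_mx 0 (H j))) = 0.
Proof.
rewrite /part1 row_mxKl row_mxKr linear0 -[RHS]row_mx0; congr row_mx.
by apply/rowP => i; rewrite !mxE eq_lrshift andbF.
Qed.

Lemma part2_dy1 j : part2 (row_mx 0 (delta_mx 0 (L j))) = 0.
Proof.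
rewrite /part2 row_mxKl row_mxKr linear0 -[RHS]row_mx0; congr row_mx.
by apply/rowP => i; rewrite !mxE eq_rlshift andbF.
Qed.

Lemma part2_dy2 j : part2 (row_mx 0 (delta_mx 0 (H j))) = row_mx 0 (delta_mx 0 j).
Proof.
rewrite /part2 row_mxKl row_mxKr linear0; congr row_mx.
by apply/rowP => i; rewrite !mxE (inj_eq (@rshift_inj _ _)).
Qed.

Context (F1 : tangent M1 -> R) (F2 : tangent M2 -> R)
  (hF1 : is_finsler F1) (hF2 : is_finsler F2)
  (f1 : M1 -> R) (f2 : M2 -> R) (hf1 : smooth_fun f1) (hf2 : smooth_fun f2)
  (f1_gt0 : forall q, 0 < f1 q) (f2_gt0 : forall q, 0 < f2 q).
Local Notation E := (energy (doubly_warped F1 F2 f1 f2) c).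
Local Notation E1 := (fun w1 => local_expr F1 c.1 w1 ^+ 2).
Local Notation E2 := (fun w2 => local_expr F2 c.2 w2 ^+ 2).

(** [warp1] multiplies the energy of [F2], and [warp2] that of [F1]. They take base and fibre
    coordinates together so as to compose with [part1] and [part2]. *)
Definition warp1 (w1 : 'rV[R]_(m + m)) : R := f1 (Defs.point c.1 (lsubmx w1)) ^+ 2.
Definition warp2 (w2 : 'rV[R]_(n + n)) : R := f2 (Defs.point c.2 (lsubmx w2)) ^+ 2.

Lemma energyE w :
  E w = warp2 (part2 w) * E1 (part1 w) + warp1 (part1 w) * E2 (part2 w).
Proof.
rewrite /energy /doubly_warped sqr_sqrtr.
  by rewrite /warp1 /warp2 /local_expr /part1 /part2 !row_mxKl !row_mxKr.
by rewrite addr_ge0 // mulr_ge0 // sqr_ge0.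
Qed.

Lemma smooth_energy : smooth_on U E.
Proof.
have oU := slit_chart_open.
rewrite (_ : E = fun w => (warp2 \o part2) w * (E1 \o part1) w
    + (warp1 \o part1) w * (E2 \o part2) w); last by apply/funext => w; exact: energyE.
apply: smooth_onD => //; apply: smooth_onM => //.
- exact/smooth_on_part2/smooth_fun_slit.
- exact/smooth_on_part1/smooth_local_expr_sqr.
- exact/smooth_on_part1/smooth_fun_slit.
- exact/smooth_on_part2/smooth_local_expr_sqr.
Qed.

Lemma warp1_dy v k w : lsubmx (part1 v) = 0 ->
  warp1 (part1 (k *: v + w)) = warp1 (part1 w).
Proof. by move=> v0; rewrite /warp1 linearD linearZ linearD linearZ /= v0 scaler0 add0r. Qed.

Lemma warp2_dy v k w : lsubmx (part2 v) = 0 ->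
  warp2 (part2 (k *: v + w)) = warp2 (part2 w).
Proof. by move=> v0; rewrite /warp2 linearD linearZ linearD linearZ /= v0 scaler0 add0r. Qed.

Lemma const_along_part1 (g : 'rV[R]_(m + m) -> R) v k w : part1 v = 0 ->
  g (part1 (k *: v + w)) = g (part1 w).
Proof. by move=> v0; rewrite linearP /= v0 scaler0 add0r. Qed.

Lemma const_along_part2 (g : 'rV[R]_(n + n) -> R) v k w : part2 v = 0 ->
  g (part2 (k *: v + w)) = g (part2 w).
Proof. by move=> v0; rewrite linearP /= v0 scaler0 add0r. Qed.

Lemma dy_energy1 j w : U w ->
  dy E (L j) w = warp2 (part2 w) * dy E1 j (part1 w).
Proof.
move=> /slit_chartP[S1w S2w].
rewrite /dy (_ : E = fun w => warp2 (part2 w) * E1 (part1 w)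
    + warp1 (part1 w) * E2 (part2 w)); last by apply/funext => z; exact: energyE.
rewrite -part1_dy1; apply: derive_slice => [k|k|].
- by apply: warp2_dy; rewrite part2_dy1 linear0.
- rewrite warp1_dy ?part1_dy1 ?row_mxKl //; congr (_ * _).
  by apply: (const_along_part2 E2); exact: part2_dy1.
- exact/diff_derivable/(smooth_on_differentiable (smooth_local_expr_sqr hF1) S1w).
Qed.

Lemma dy_energy2 j w : U w ->
  dy E (H j) w = warp1 (part1 w) * dy E2 j (part2 w).
Proof.
move=> /slit_chartP[S1w S2w].
rewrite /dy (_ : E = fun w => warp1 (part1 w) * E2 (part2 w)
    + warp2 (part2 w) * E1 (part1 w)); last first.
  by apply/funext => z; rewrite energyE addrC.
rewrite -part2_dy2; apply: derive_slice => [k|k|].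
- by apply: warp1_dy; rewrite part1_dy2 linear0.
- rewrite warp2_dy ?part2_dy2 ?row_mxKl //; congr (_ * _).
  by apply: (const_along_part1 E1); exact: part1_dy2.
- exact/diff_derivable/(smooth_on_differentiable (smooth_local_expr_sqr hF2) S2w).
Qed.

(** The general [g] serves twice: as [dy E1 j] for the fundamental tensor and as an entry of that
    tensor for its y-derivatives. *)
Lemma dy_warp2_part1 (g : 'rV[R]_(m + m) -> R) i w : smooth_on S1 g -> U w ->
  dy (fun z => warp2 (part2 z) * g (part1 z)) (L i) w
  = warp2 (part2 w) * dy g i (part1 w).
Proof.
move=> gs /slit_chartP[S1w S2w].
rewrite /dy (_ : (fun z => _) = fun z => warp2 (part2 z) * g (part1 z) + 0).
  rewrite -part1_dy1; apply: (@derive_slice _ _ _ _ _ (fun=> 0)) => // [k|].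
    by apply: warp2_dy; rewrite part2_dy1 linear0.
  exact/diff_derivable/(smooth_on_differentiable gs S1w).
by apply/funext => z; rewrite addr0.
Qed.

Lemma dy_warp2_part1_0 (g : 'rV[R]_(m + m) -> R) a w : smooth_on S1 g -> U w ->
  dy (fun z => warp2 (part2 z) * g (part1 z)) (H a) w = 0.
Proof.
move=> gs /slit_chartP[S1w S2w].
rewrite /dy (_ : (fun z => _) = fun z => warp2 (part2 z) * g (part1 z) + 0).
  rewrite (@derive_slice _ _ _ _ (warp2 \o part2) (fun=> 0)) // => [|k|].
  - by rewrite /= part1_dy2 derive0 mulr0.
  - by apply: warp2_dy; rewrite part2_dy2 row_mxKl.
  - exact/diff_derivable/(smooth_on_differentiable gs S1w).
by apply/funext => z; rewrite addr0.
Qed.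

Lemma dy_warp1_part2 (g : 'rV[R]_(n + n) -> R) i w : smooth_on S2 g -> U w ->
  dy (fun z => warp1 (part1 z) * g (part2 z)) (H i) w
  = warp1 (part1 w) * dy g i (part2 w).
Proof.
move=> gs /slit_chartP[S1w S2w].
rewrite /dy (_ : (fun z => _) = fun z => warp1 (part1 z) * g (part2 z) + 0).
  rewrite -part2_dy2; apply: (@derive_slice _ _ _ _ _ (fun=> 0)) => // [k|].
    by apply: warp1_dy; rewrite part1_dy2 linear0.
  exact/diff_derivable/(smooth_on_differentiable gs S2w).
by apply/funext => z; rewrite addr0.
Qed.

Lemma dy_warp1_part2_0 (g : 'rV[R]_(n + n) -> R) a w : smooth_on S2 g -> U w ->
  dy (fun z => warp1 (part1 z) * g (part2 z)) (L a) w = 0.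
Proof.
move=> gs /slit_chartP[S1w S2w].
rewrite /dy (_ : (fun z => _) = fun z => warp1 (part1 z) * g (part2 z) + 0).
  rewrite (@derive_slice _ _ _ _ (warp1 \o part1) (fun=> 0)) // => [|k|].
  - by rewrite /= part2_dy1 derive0 mulr0.
  - by apply: warp1_dy; rewrite part1_dy1 row_mxKl.
  - exact/diff_derivable/(smooth_on_differentiable gs S2w).
by apply/funext => z; rewrite addr0.
Qed.

Let oU := slit_chart_open.
Let sE1 := smooth_local_expr_sqr (c := c.1) hF1.
Let sE2 := smooth_local_expr_sqr (c := c.2) hF2.
Let sdE1 j : smooth_on S1 (dy E1 j) := smooth_on_derive _ sE1.
Let sdE2 j : smooth_on S2 (dy E2 j) := smooth_on_derive _ sE2.

Lemma fund_tensor11 i j w : U w ->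
  fund_tensor E w (L i) (L j) = warp2 (part2 w) * fund_tensor E1 (part1 w) i j.
Proof.
move=> Uw; rewrite [fund_tensor E1 _ _ _]mxE mulrCA -(dy_warp2_part1 i (sdE1 j) Uw) mxE.
congr (_ * _); apply: (eq_in_derive _ oU); last by rewrite inE.
by move=> z; rewrite inE => Uz; exact: dy_energy1.
Qed.

Lemma fund_tensor22 i j w : U w ->
  fund_tensor E w (H i) (H j) = warp1 (part1 w) * fund_tensor E2 (part2 w) i j.
Proof.
move=> Uw; rewrite [fund_tensor E2 _ _ _]mxE mulrCA -(dy_warp1_part2 i (sdE2 j) Uw) mxE.
congr (_ * _); apply: (eq_in_derive _ oU); last by rewrite inE.
by move=> z; rewrite inE => Uz; exact: dy_energy2.
Qed.

Lemma fund_tensor21 i j w : U w -> fund_tensor E w (H i) (L j) = 0.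
Proof.
move=> Uw; rewrite -[RHS](mulr0 2%:R^-1) -(dy_warp2_part1_0 i (sdE1 j) Uw) mxE.
congr (_ * _); apply: (eq_in_derive _ oU); last by rewrite inE.
by move=> z; rewrite inE => Uz; exact: dy_energy1.
Qed.

Lemma fund_tensor12 i j w : U w -> fund_tensor E w (L i) (H j) = 0.
Proof.
by move=> Uw; rewrite (fund_tensorC oU smooth_energy) // fund_tensor21.
Qed.

Lemma warp1_gt0 w1 : 0 < warp1 w1. Proof. exact: exprn_gt0. Qed.
Lemma warp2_gt0 w2 : 0 < warp2 w2. Proof. exact: exprn_gt0. Qed.

(** The diagonal blocks are invertible matrices scaled by the positive warp factors. *)
Lemma energy_unitmx w : U w -> fund_tensor E w \in unitmx.
Proof.
move=> Uw; have /slit_chartP[S1w S2w] := Uw.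
have -> : fund_tensor E w = block_mx (warp2 (part2 w) *: fund_tensor E1 (part1 w)) 0
                                    0 (warp1 (part1 w) *: fund_tensor E2 (part2 w)).
  apply/matrixP => a b.
  have [i ->|i ->] := split_ordP a; have [j ->|j ->] := split_ordP b.
  - by rewrite block_mxEul fund_tensor11 // [RHS]mxE.
  - by rewrite block_mxEur fund_tensor12 // mxE.
  - by rewrite block_mxEdl fund_tensor21 // mxE.
  - by rewrite block_mxEdr fund_tensor22 // [RHS]mxE.
rewrite unitmxE det_ublock unitrM -!unitmxE !unitmxZ ?unitfE ?gt_eqF ?warp1_gt0 ?warp2_gt0 //.
by rewrite !finsler_unitmx.
Qed.

Lemma dy_fund_tensor111 i j k w : U w ->
  dy (fun z => fund_tensor E z (L i) (L j)) (L k) w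
  = warp2 (part2 w) * dy (fun z => fund_tensor E1 z i j) k (part1 w).
Proof.
move=> Uw; rewrite -(dy_warp2_part1 k (smooth_fund_tensor _ sE1 i j) Uw);
  last exact: slit_image_open.
apply: (eq_in_derive _ oU); last by rewrite inE.
by move=> z; rewrite inE => Uz; exact: fund_tensor11.
Qed.

Lemma dy_fund_tensor112 i j k w : U w ->
  dy (fun z => fund_tensor E z (L i) (L j)) (H k) w = 0.
Proof.
move=> Uw; rewrite -(dy_warp2_part1_0 k (smooth_fund_tensor _ sE1 i j) Uw);
  last exact: slit_image_open.
apply: (eq_in_derive _ oU); last by rewrite inE.
by move=> z; rewrite inE => Uz; exact: fund_tensor11.
Qed.

Lemma dy_fund_tensor222 i j k w : U w ->
  dy (fun z => fund_tensor E z (H i) (H j)) (H k) w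
  = warp1 (part1 w) * dy (fun z => fund_tensor E2 z i j) k (part2 w).
Proof.
move=> Uw; rewrite -(dy_warp1_part2 k (smooth_fund_tensor _ sE2 i j) Uw);
  last exact: slit_image_open.
apply: (eq_in_derive _ oU); last by rewrite inE.
by move=> z; rewrite inE => Uz; exact: fund_tensor22.
Qed.

Lemma dy_fund_tensor221 i j k w : U w ->
  dy (fun z => fund_tensor E z (H i) (H j)) (L k) w = 0.
Proof.
move=> Uw; rewrite -(dy_warp1_part2_0 k (smooth_fund_tensor _ sE2 i j) Uw);
  last exact: slit_image_open.
apply: (eq_in_derive _ oU); last by rewrite inE.
by move=> z; rewrite inE => Uz; exact: fund_tensor22.
Qed.

Lemma dy_fund_tensor12 i j a w : U w ->
  dy (fun z => fund_tensor E z (L i) (H j)) a w = 0.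
Proof.
move=> Uw; rewrite /dy -[RHS](derive_cst (0 : R) w (row_mx 0 (delta_mx 0 a))).
apply: (eq_in_derive _ oU); last by rewrite inE.
by move=> z; rewrite inE => Uz; exact: fund_tensor12.
Qed.

Lemma dy_fund_tensor21 i j a w : U w ->
  dy (fun z => fund_tensor E z (H i) (L j)) a w = 0.
Proof. by move=> Uw; rewrite (dy_fund_tensorC oU smooth_energy) // dy_fund_tensor12. Qed.

End SlitChart.

(** * Splitting of the Cartan tensor *)

Section WarpedCartan.
Context (R : realType) (m n : nat) (M1 : manifold R m) (M2 : manifold R n)
  (c : chart (slit_atlas M1 M2))
  (F1 : tangent M1 -> R) (F2 : tangent M2 -> R)
  (hF1 : is_finsler F1) (hF2 : is_finsler F2)
  (f1 : M1 -> R) (f2 : M2 -> R) (hf1 : smooth_fun f1) (hf2 : smooth_fun f2)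
  (f1_gt0 : forall q, 0 < f1 q) (f2_gt0 : forall q, 0 < f2 q).
Local Notation U := (chart_image c).
Local Notation E := (energy (doubly_warped F1 F2 f1 f2) c).
Local Notation E1 := (fun w1 => local_expr F1 c.1 w1 ^+ 2).
Local Notation E2 := (fun w2 => local_expr F2 c.2 w2 ^+ 2).
Local Notation L := (@lshift m n).
Local Notation H := (@rshift m n).

Let gU := energy_unitmx hF1 hF2 hf1 hf2 f1_gt0 f2_gt0 (c := c).

(** Candidate values [y1], [y2] need only be tested in the lowered equations, which have a unique
    solution. *)
Lemma cartan_split w a b (y1 : 'I_m -> R) (y2 : 'I_n -> R) : U w ->
  (forall e, \sum_k fund_tensor E w e (L k) * y1 k
           + \sum_k fund_tensor E w e (H k) * y2 k
    = 2%:R^-1 * dy (fun z => fund_tensor E z a b) e w) ->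
  (forall k, cartan E (L k) a b w = y1 k) /\ (forall k, cartan E (H k) a b w = y2 k).
Proof.
move=> Uw Hy; pose y d := row_mx (\row_k y1 k) (\row_k y2 k) 0 d.
have yL k : y (L k) = y1 k by rewrite /y row_mxEl mxE.
have yH k : y (H k) = y2 k by rewrite /y row_mxEr mxE.
have cy : (fun d => cartan E d a b w) =1 y.
  apply: (fund_tensor_inj gU Uw) => e.
  rewrite (fund_tensor_cartan gU) // -Hy big_split_ord /=.
  by congr (_ + _); apply: eq_bigr => k _; rewrite ?yL ?yH.
by split=> k; rewrite -?yL -?yH; exact: cy.
Qed.

Lemma cartan11 i j w : U w ->
  (forall k, cartan E (L k) (L i) (L j) w = cartan E1 k i j (part1 w)) /\
  (forall k, cartan E (H k) (L i) (L j) w = 0).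
Proof.
move=> Uw; have /slit_chartP[S1w _] := Uw.
apply: (cartan_split (y2 := fun=> 0)) => // e.
rewrite [X in _ + X]big1 ?addr0 => [|k _]; last by rewrite mulr0.
have [h ->|h ->] := split_ordP e.
  (* Both sides carry the factor [warp2]; what remains is the lowered equation for [F1]. *)
  under eq_bigr do rewrite fund_tensor11 // -mulrA.
  rewrite -mulr_sumr (fund_tensor_cartan (finsler_unitmx hF1 (c := c.1))) //.
  by rewrite mulrCA dy_fund_tensor111.
rewrite dy_fund_tensor112 // mulr0 big1 // => k _.
by rewrite fund_tensor21 // mul0r.
Qed.

Lemma cartan22 i j w : U w ->
  (forall k, cartan E (L k) (H i) (H j) w = 0) /\
  (forall k, cartan E (H k) (H i) (H j) w = cartan E2 k i j (part2 w)).
Proof.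
move=> Uw; have /slit_chartP[_ S2w] := Uw.
apply: (cartan_split (y1 := fun=> 0)) => // e.
rewrite [X in X + _]big1 ?add0r => [|k _]; last by rewrite mulr0.
have [h ->|h ->] := split_ordP e; last first.
  under eq_bigr do rewrite fund_tensor22 // -mulrA.
  rewrite -mulr_sumr (fund_tensor_cartan (finsler_unitmx hF2 (c := c.2))) //.
  by rewrite mulrCA dy_fund_tensor222.
rewrite dy_fund_tensor221 // mulr0 big1 // => k _.
by rewrite fund_tensor12 // mul0r.
Qed.

Lemma cartan12 i j w : U w -> forall k, cartan E k (L i) (H j) w = 0.
Proof.
move=> Uw k; rewrite /cartan big1 ?mulr0 // => e _.
by rewrite dy_fund_tensor12 // mulr0.
Qed.

Lemma cartan21 i j w : U w -> forall k, cartan E k (H i) (L j) w = 0.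
Proof.
move=> Uw k; rewrite /cartan big1 ?mulr0 // => e _.
by rewrite dy_fund_tensor21 // mulr0.
Qed.

End WarpedCartan.

Theorem proposition5 (R : realType) (m n : nat)
    (M1 : manifold R m) (M2 : manifold R n)
    (F1 : tangent M1 -> R) (F2 : tangent M2 -> R)
    (hF1 : is_finsler F1) (hF2 : is_finsler F2)
    (f1 : M1 -> R) (f2 : M2 -> R)
    (hf1 : smooth_fun f1) (hf2 : smooth_fun f2)
    (f1_gt0 : forall p, 0 < f1 p) (f2_gt0 : forall p, 0 < f2 p)
    (nabla : chart (slit_atlas M1 M2) ->
       ('rV[R]_((m + n) + (m + n)) -> 'rV[R]_((m + n) + (m + n))) ->
       ('rV[R]_((m + n) + (m + n)) -> 'rV[R]_((m + n) + (m + n))) ->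
       'rV[R]_((m + n) + (m + n)) -> 'rV[R]_((m + n) + (m + n)))
    (hnabla : vaisman_connection (doubly_warped F1 F2 f1 f2) nabla)
    (c : chart (slit_atlas M1 M2)) (w : 'rV[R]_((m + n) + (m + n)))
    (hw : chart_image c w) :
  let E := energy (doubly_warped F1 F2 f1 f2) c in
  let G := berwald E in
  let F := chern E in
  let C1 k i j := cartan (fun w1 => local_expr F1 c.1 w1 ^+ 2) k i j (part1 w) in
  let C2 k i j := cartan (fun w2 => local_expr F2 c.2 w2 ^+ 2) k i j (part2 w) in
  let L := @lshift m n in
  let H := @rshift m n in
  let hx i := hframe E (L i) in
  let hu a := hframe E (H a) in
  let vy i := @vframe R (m + n) (L i) in
  let vv a := @vframe R (m + n) (H a) in
  (forall i j, nabla c (hx i) (vy j) w =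
     \sum_k G (L k) (L i) (L j) w *: vy k w
     + \sum_e G (H e) (L i) (L j) w *: vv e w) /\
  (forall a b, nabla c (hu a) (vv b) w =
     \sum_k G (L k) (H a) (H b) w *: vy k w
     + \sum_e G (H e) (H a) (H b) w *: vv e w) /\
  (forall a j, nabla c (hu a) (vy j) w =
     \sum_k G (L k) (H a) (L j) w *: vy k w
     + \sum_e G (H e) (H a) (L j) w *: vv e w) /\
  (forall i b, nabla c (hx i) (vv b) w =
     \sum_k G (L k) (L i) (H b) w *: vy k w
     + \sum_e G (H e) (L i) (H b) w *: vv e w) /\
  (forall i j, nabla c (hx i) (hx j) w =
     \sum_k F (L k) (L i) (L j) w *: hx k w
     + \sum_e F (H e) (L i) (L j) w *: hu e w) /\
  (forall a b, nabla c (hu a) (hu b) w =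
     \sum_k F (L k) (H a) (H b) w *: hx k w
     + \sum_e F (H e) (H a) (H b) w *: hu e w) /\
  (forall i b, nabla c (hx i) (hu b) w =
     \sum_k F (L k) (L i) (H b) w *: hx k w
     + \sum_e F (H e) (L i) (H b) w *: hu e w) /\
  (forall a j, nabla c (hu a) (hx j) w =
     \sum_k F (L k) (H a) (L j) w *: hx k w
     + \sum_e F (H e) (H a) (L j) w *: hu e w) /\
  (forall i j, nabla c (vy i) (vy j) w = \sum_k C1 k i j *: vy k w) /\
  (forall a b, nabla c (vv a) (vv b) w = \sum_e C2 e a b *: vv e w) /\
  (forall i b, nabla c (vy i) (vv b) w = 0) /\
  (forall a j, nabla c (vv a) (vy j) w = 0) /\
  (forall i j, nabla c (vy i) (hx j) w = 0) /\
  (forall a j, nabla c (vv a) (hx j) w = 0) /\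
  (forall a b, nabla c (vv a) (hu b) w = 0) /\
  (forall i b, nabla c (vy i) (hu b) w = 0).
Proof.
have oU : open (chart_image c) by exact: slit_chart_open.
have sE := smooth_energy hF1 hF2 hf1 hf2 (c := c).
have gU := energy_unitmx hF1 hF2 hf1 hf2 f1_gt0 f2_gt0 (c := c).
move=> E G F C1 C2 L H hx hu vy vv.
(* Here [a] and [b] range over the indices of both manifolds, so one formula covers four cases of
   the statement; [big_split_ord] separates the components. *)
have hv a b : nabla c (hframe E a) (vframe b) w
    = \sum_k G (L k) a b w *: vy k w + \sum_e G (H e) a b w *: vv e w.
  by rewrite (vaisman_hv hnabla oU sE gU) // big_split_ord.
have hh a b : nabla c (hframe E a) (hframe E b) w
    = \sum_k F (L k) a b w *: hx k w + \sum_e F (H e) a b w *: hu e w.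
  by rewrite (vaisman_hh hnabla oU sE gU) // big_split_ord.
have vv' a b : nabla c (vframe a) (vframe b) w
    = \sum_k cartan E (L k) a b w *: vy k w + \sum_e cartan E (H e) a b w *: vv e w.
  by rewrite (vaisman_vv hnabla oU sE gU) // big_split_ord.
have vh a b : nabla c (vframe a) (hframe E b) w = 0.
  exact: (vaisman_vh hnabla oU sE gU).
do 8 (split; first by move=> ? ?; exact: hv || exact: hh).
split=> [i j|].
  have [cL cH] := cartan11 hF1 hF2 hf1 hf2 f1_gt0 f2_gt0 i j hw.
  rewrite vv' [X in _ + X]big1 ?addr0 => [|e _]; last by rewrite cH scale0r.
  by apply: eq_bigr => k _; rewrite cL.
split=> [i j|].
  have [cL cH] := cartan22 hF1 hF2 hf1 hf2 f1_gt0 f2_gt0 i j hw.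
  rewrite vv' [X in X + _]big1 ?add0r => [|e _]; last by rewrite cL scale0r.
  by apply: eq_bigr => k _; rewrite cH.
split=> [i b|].
  by rewrite vv' !big1 ?addr0 // => k _; rewrite cartan12 ?scale0r.
split=> [a j|].
  by rewrite vv' !big1 ?addr0 // => k _; rewrite cartan21 ?scale0r.
by do !split=> *; exact: vh.
Qed.
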